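(* Let $(R,\mathfrak{m})$ be a Cohen–Macaulay local ring of dimension $4$ with infinite residue field. Let $I$ be an $\mathfrak{m}$-primary ideal and $J$ a minimal reduction of $I$. If $I$ is asymptotically normal and $r_J(I)\le 3$, then $e_4(I)\le 0$.
   Context: For an $\mathfrak{m}$-primary ideal $I$, $\lambda(R/I^n)$ agrees for all large $n$ with $P_I(n)=e_0\binom{n+3}{4}-e_1\binom{n+2}{3}+e_2\binom{n+1}{2}-e_3\binom{n}{1}+e_4$; the $e_i(I)$ are the Hilbert coefficients. A reduction $J\subseteq I$ satisfies $I^{r+1}=JI^r$ for some $r\ge0$; the least such $r$ is $r_J(I)$; a minimal reduction is a reduction minimal under inclusion. $I$ is asymptotically normal if there is $k\ge1$ such that $I^n$ is integrally closed for all $n\ge k$. *)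

(* Defs.v *)
From HB Require Import structures.
From mathcomp Require Import all_boot all_order all_algebra.
Set Implicit Arguments. Unset Strict Implicit. Unset Printing Implicit Defensive.
Import Order.TTheory GRing.Theory Num.Theory.
Local Open Scope ring_scope.

Section CommAlg.
Variable R : comNzRingType.

Definition ideal := R -> Prop.

Definition is_ideal (I : ideal) : Prop :=
  [/\ I 0, (forall x y, I x -> I y -> I (x + y)) & (forall a x, I x -> I (a * x))].

Definition unit_ideal : ideal := fun _ => True.

Definition isub (I J : ideal) : Prop := forall x, I x -> J x.
Definition ieq (I J : ideal) : Prop := forall x, I x <-> J x.
Definition iproper_sub (I J : ideal) : Prop := isub I J /\ ~ isub J I.

Definition imul (I J : ideal) : ideal := fun x =>
  exists s : seq (R * R),
    (forall p, p \in s -> I p.1 /\ J p.2) /\ x = \sum_(p <- s) p.1 * p.2.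

Definition ipow (I : ideal) (n : nat) : ideal := iter n (imul I) unit_ideal.

Definition gen_ideal (s : seq R) : ideal := fun x =>
  exists c : nat -> R, x = \sum_(i < size s) c i * s`_i.

Definition is_proper_ideal (I : ideal) : Prop := is_ideal I /\ ~ I 1.

Definition is_prime_ideal (P : ideal) : Prop :=
  is_proper_ideal P /\ forall x y, P (x * y) -> P x \/ P y.

Definition is_maximal_ideal (M : ideal) : Prop :=
  is_proper_ideal M /\
  forall J, is_proper_ideal J -> isub M J -> isub J M.

Definition is_noetherian : Prop :=
  forall I, is_ideal I -> exists s : seq R, ieq I (gen_ideal s).

Definition is_local (m : ideal) : Prop :=
  is_maximal_ideal m /\ forall M, is_maximal_ideal M -> ieq M m.

Definition prime_chain (P : nat -> ideal) (k : nat) : Prop :=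
  (forall i, (i <= k)%N -> is_prime_ideal (P i)) /\
  (forall i, (i < k)%N -> iproper_sub (P i) (P i.+1)).

Definition krull_dim (d : nat) : Prop :=
  (exists P, prime_chain P d) /\ (forall P k, prime_chain P k -> (k <= d)%N).

Definition regular_seq (x : seq R) : Prop :=
  (forall i, (i < size x)%N -> forall y,
      gen_ideal (take i x) (x`_i * y) -> gen_ideal (take i x) y) /\
  ~ gen_ideal x 1.

(* Cohen-Macaulay local ring of dimension d: depth R = dim R = d, i.e.
   there is an R-regular sequence of length d in m (depth <= dim always). *)
Definition cohen_macaulay_local (m : ideal) (d : nat) : Prop :=
  is_noetherian /\ is_local m /\ krull_dim d /\
  exists x : seq R, size x = d /\ (forall y, y \in x -> m y) /\ regular_seq x.

Definition infinite_residue_field (m : ideal) : Prop :=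
  exists f : nat -> R, forall i j, m (f i - f j) -> i = j.

Definition m_primary (m I : ideal) : Prop :=
  is_proper_ideal I /\ forall x, m x <-> exists n, I (x ^+ n).

Definition ideal_chain (I : ideal) (C : nat -> ideal) (n : nat) : Prop :=
  ieq (C 0%N) I /\ ieq (C n) unit_ideal /\
  (forall i, (i <= n)%N -> is_ideal (C i)) /\
  (forall i, (i < n)%N -> iproper_sub (C i) (C i.+1)).

Definition length_quot (I : ideal) (n : nat) : Prop :=
  (exists C, ideal_chain I C n) /\ (forall C k, ideal_chain I C k -> (k <= n)%N).

Definition is_reduction (J I : ideal) : Prop :=
  is_ideal J /\ isub J I /\ exists r, ieq (ipow I r.+1) (imul J (ipow I r)).

Definition is_minimal_reduction (J I : ideal) : Prop :=
  is_reduction J I /\ forall K, is_reduction K I -> isub K J -> ieq K J.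

Definition red_num_le (J I : ideal) (r : nat) : Prop :=
  exists r', (r' <= r)%N /\ ieq (ipow I r'.+1) (imul J (ipow I r')).

Definition integral_over (I : ideal) (x : R) : Prop :=
  exists (n : nat) (a : nat -> R), (0 < n)%N /\
    (forall i, (1 <= i <= n)%N -> ipow I i (a i)) /\
    x ^+ n + \sum_(1 <= i < n.+1) a i * x ^+ (n - i) = 0.

Definition integrally_closed (I : ideal) : Prop :=
  forall x, integral_over I x -> I x.

Definition asymptotically_normal (I : ideal) : Prop :=
  exists k, (1 <= k)%N /\ forall n, (k <= n)%N -> integrally_closed (ipow I n).

End CommAlg.

Definition hilb_poly4 (e0 e1 e2 e3 e4 : int) (n : nat) : int :=
  (e0 * ('C(n + 3, 4))%:Z - e1 * ('C(n + 2, 3))%:Z + e2 * ('C(n + 1, 2))%:Z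
   - e3 * n%:Z + e4)%R.

Definition hilbert_coeffs4 (R : comNzRingType) (I : ideal R)
  (e0 e1 e2 e3 e4 : int) : Prop :=
  exists N, forall n, (N <= n)%N ->
    exists l, length_quot (ipow I n) l /\ l%:Z = hilb_poly4 e0 e1 e2 e3 e4 n.

(* Main.v *)
(** J is generated by a regular sequence x_1, ..., x_4: over the infinite residue
    field, four general elements of J form a regular sequence and are superficial,
    so that, the Hilbert function having degree 4, they already generate a
    reduction.

    For large s put K = I^s and y_i = x_i^s; the y_i form a regular sequence, all
    powers of K are integrally closed, and r_J(I) <= 3 gives K^4 = (y) K^3. In the
    Koszul complex
      (R/K)^4 -> (R/K^2)^6 -> (R/K^3)^4 -> R/K^4
    the cohomology at (R/K^3)^4 vanishes because y is regular and K^4 = (y) K^3,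
    and at (R/K)^4 because K is normal. Counting lengths, with H the Hilbert function of I,
      H(4s) - 4 H(3s) + 6 H(2s) - 4 H(s) >= length R/(y) >= e_0 s^4,
    and the left hand side is e_0 s^4 - e_4.

    The vanishing at (R/K)^4: let y_j a_i - y_i a_j lie in K^2 for all i, j, and
    suppose that all a_i have order >= h/N < 1 for the asymptotic Samuel function
    of K. Multiplication by g = a_i^N/y_i^N lowers degrees by N - h in the reduced
    associated graded ring, and iterating it brings the many monomials in y_1, y_2
    of large degree into one piece of bounded length. A relation g^M F(y) = 0
    results, where F is monic and hence F(y) is not a zero divisor; so all a_i
    have order > h/N. Nilpotents of the associated graded ring have bounded index
    D, so the gain is at least 1/(ND), and a Stern-Brocot descent shows that such
    a gain for every h/N below the order is impossible unless that order is >= 1. *)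

Require Import Defs.
From HB Require Import structures.
From mathcomp Require Import all_boot all_order all_algebra.
From mathcomp Require Import ring lra zify.
From Stdlib Require Import Classical ClassicalEpsilon FunctionalExtensionality PropExtensionality.
Set Implicit Arguments. Unset Strict Implicit. Unset Printing Implicit Defensive.
Import Order.TTheory GRing.Theory Num.Theory.
Local Open Scope ring_scope.

(** * Ideals *)

(** The binomial combination of values of $H$ is a fourth difference of step $s$ from which only the
    term $P(0)=e_4$ is missing, so it suffices to bound it below. Nothing is known about the
    cohomology of the Koszul complex at $(R/K^2)^6$; it enters the Euler characteristic with the
    favourable sign, so vanishing at its two neighbours is enough. Passing to $K=I^s$ keeps
    reduction number 3: a monomial of degree $4s-3$ in four elements contains an $s$-th power of one
    of them, and here the bound $3=4-1$ is exact. The hard point is the vanishing at $(R/K)^4$.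
    Although all powers of $K$ are integrally closed, its associated graded ring need not be
    reduced: orders of elements are fractions $h/N$, and congruences can only be kept modulo
    nilpotents. Gains over each $h/N$ might accumulate below 1; hence the size $1/(ND)$ of a gain is
    compared with the distance $1/(NN')$ of neighbouring fractions. *)

Section Ideals.
Variable R : comNzRingType.
Implicit Types (I J K A B N : ideal R) (x y z : R) (s ys : seq R).

(** Ideals are predicates; extensionality turns pointwise equivalence into Leibniz equality, so
    identities between ideals can be used for rewriting. *)
Lemma ideal_ext I J : (forall x, I x <-> J x) -> I = J.
Proof.
move=> h; apply: functional_extensionality => x.
exact: propositional_extensionality.
Qed.

Lemma isub_antisym I J : isub I J -> isub J I -> I = J.
Proof. by move=> h1 h2; apply: ideal_ext => x; split=> [/h1|/h2]. Qed.

Lemma isub_refl I : isub I I. Proof. by []. Qed.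
Hint Resolve isub_refl : core.

Lemma isub_trans J I K : isub I J -> isub J K -> isub I K.
Proof. by move=> h1 h2 x /h1/h2. Qed.

Lemma id0 I : is_ideal I -> I 0. Proof. by case. Qed.
Lemma idD I x y : is_ideal I -> I x -> I y -> I (x + y).
Proof. by case=> _ h _; apply: h. Qed.
Lemma idMl I a x : is_ideal I -> I x -> I (a * x).
Proof. by case=> _ _; apply. Qed.
Lemma idMr I a x : is_ideal I -> I x -> I (x * a).
Proof. by rewrite mulrC; apply: idMl. Qed.
Lemma idN I x : is_ideal I -> I x -> I (- x).
Proof. by rewrite -mulN1r; apply: idMl. Qed.
Lemma idB I x y : is_ideal I -> I x -> I y -> I (x - y).
Proof. by move=> hI hx hy; apply: idD => //; apply: idN. Qed.

Lemma id_sum I (T : Type) (r : seq T) (P : pred T) (F : T -> R) :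
  is_ideal I -> (forall i, P i -> I (F i)) -> I (\sum_(i <- r | P i) F i).
Proof.
move=> hI hF; apply: (big_ind (fun x => I x)) => //; first exact: id0.
by move=> x y; apply: idD.
Qed.

Lemma unit_ideal_ideal : is_ideal (@unit_ideal R). Proof. by []. Qed.

Definition izero : ideal R := fun x => x = 0.
Definition isum I J : ideal R := fun x => exists a b, [/\ I a, J b & x = a + b].
Definition prin y : ideal R := fun x => exists r, x = r * y.

Lemma izero_ideal : is_ideal izero.
Proof. by split=> // [x y -> ->|a x ->]; rewrite /izero ?addr0 ?mulr0. Qed.

Lemma prin_ideal y : is_ideal (prin y).
Proof.
split=> [|x z [a ->] [b ->]|a x [b ->]]; first by exists 0; rewrite mul0r.
  by exists (a + b); rewrite mulrDl.
by exists (a * b); rewrite mulrA.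
Qed.

Lemma prin_mem y : prin y y. Proof. by exists 1; rewrite mul1r. Qed.

Lemma isum_ideal I J : is_ideal I -> is_ideal J -> is_ideal (isum I J).
Proof.
move=> hI hJ; split.
- by exists 0, 0; rewrite addr0; split=> //; apply: id0.
- move=> x y [a [b [ha hb ->]]] [c [d [hc hd ->]]].
  by exists (a + c), (b + d); split; [apply: idD | apply: idD | rewrite addrACA].
- move=> r x [a [b [ha hb ->]]]; exists (r * a), (r * b).
  by split; [apply: idMl | apply: idMl | rewrite mulrDr].
Qed.

Lemma isum_l I J : is_ideal J -> isub I (isum I J).
Proof. by move=> hJ x hx; exists x, 0; rewrite addr0; split=> //; apply: id0. Qed.
Lemma isum_r I J : is_ideal I -> isub J (isum I J).
Proof. by move=> hI x hx; exists 0, x; rewrite add0r; split=> //; apply: id0. Qed.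

Lemma isum_sub I J K : is_ideal K -> isub I K -> isub J K -> isub (isum I J) K.
Proof. by move=> hK h1 h2 x [a [b [/h1 ha /h2 hb ->]]]; apply: idD. Qed.

Lemma isum_mono I I' J J' : isub I I' -> isub J J' -> isub (isum I J) (isum I' J').
Proof. by move=> h1 h2 x [a [b [/h1 ha /h2 hb ->]]]; exists a, b. Qed.

Lemma isumC I J : isum I J = isum J I.
Proof.
by apply: ideal_ext => x; split=> -[a [b [ha hb ->]]]; exists b, a; rewrite addrC.
Qed.

Lemma isumA I J K : isum I (isum J K) = isum (isum I J) K.
Proof.
apply: ideal_ext => x; split.
- move=> [a [_ [ha [b [c [hb hc ->]]] ->]]]; exists (a + b), c.
  by rewrite addrA; split=> //; exists a, b.
- move=> [_ [c [[a [b [ha hb ->]]] hc ->]]]; exists a, (b + c).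
  by rewrite addrA; split=> //; exists b, c.
Qed.

Lemma isum_absorb I J : is_ideal I -> is_ideal J -> isub J I -> isum I J = I.
Proof.
by move=> hI hJ h; apply: isub_antisym; [apply: isum_sub | apply: isum_l].
Qed.

Lemma isum0 I : is_ideal I -> isum I izero = I.
Proof.
move=> hI; apply: isum_absorb => //; first exact: izero_ideal.
by move=> x ->; apply: id0.
Qed.

Lemma prin_sub y I : is_ideal I -> I y -> isub (prin y) I.
Proof. by move=> hI hy x [r ->]; apply: idMl. Qed.

Lemma mem_imul I J x y : I x -> J y -> imul I J (x * y).
Proof.
move=> hx hy; exists [:: (x, y)]; rewrite big_seq1; split=> // p.
by rewrite inE => /eqP ->.
Qed.

Lemma imul_ideal I J : is_ideal I -> is_ideal (imul I J).
Proof.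
move=> hI; split.
- by exists [::]; rewrite big_nil.
- move=> _ _ [s [hs ->]] [t [ht ->]]; exists (s ++ t); rewrite big_cat.
  by split=> // p; rewrite mem_cat => /orP[/hs|/ht].
- move=> a _ [s [hs ->]]; exists [seq (a * p.1, p.2) | p <- s]; split.
    by move=> _ /mapP[p /hs [h1 h2] ->]; split=> //; apply: idMl.
  by rewrite big_map mulr_sumr; apply: eq_bigr => p _; rewrite mulrA.
Qed.

Lemma imul_sub I J K : is_ideal K -> (forall x y, I x -> J y -> K (x * y)) ->
  isub (imul I J) K.
Proof.
move=> hK h _ [s [hs ->]]; rewrite big_seq_cond; apply: id_sum => // p.
by rewrite andbT => /hs [h1 h2]; apply: h.
Qed.

Lemma imul_mono I I' J J' : isub I I' -> isub J J' -> isub (imul I J) (imul I' J').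
Proof.
by move=> h1 h2 _ [s [hs ->]]; exists s; split=> // p /hs [/h1 ? /h2 ?].
Qed.

Lemma imulC I J : is_ideal I -> is_ideal J -> imul I J = imul J I.
Proof.
by move=> hI hJ; apply: isub_antisym; apply: imul_sub;
  [exact: imul_ideal| |exact: imul_ideal|]; move=> x y hx hy;
  rewrite mulrC; apply: mem_imul.
Qed.

Lemma imul_subr I J : is_ideal J -> isub (imul I J) J.
Proof. by move=> hJ; apply: imul_sub => // x y _ hy; apply: idMl. Qed.
Lemma imul_subl I J : is_ideal I -> isub (imul I J) I.
Proof. by move=> hJ; apply: imul_sub => // x y hx _; apply: idMr. Qed.

Lemma imul1l I : is_ideal I -> imul (@unit_ideal R) I = I.
Proof.
move=> hI; apply: isub_antisym; first exact: imul_subr.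
by move=> x hx; rewrite -[x]mul1r; apply: mem_imul.
Qed.

Lemma imulA I J K : is_ideal I -> is_ideal J -> is_ideal K ->
  imul I (imul J K) = imul (imul I J) K.
Proof.
move=> hI hJ hK; have hIJ := imul_ideal J hI; have hJK := imul_ideal K hJ.
apply: isub_antisym; apply: imul_sub; try exact: imul_ideal.
- move=> x y hx [s [hs ->]]; rewrite mulr_sumr big_seq_cond.
  apply: id_sum => [|p]; first exact: imul_ideal.
  by rewrite andbT mulrA => /hs [h1 h2]; do 2!apply: mem_imul => //.
- move=> x y [s [hs ->]] hy; rewrite mulr_suml big_seq_cond.
  apply: id_sum => [|p]; first exact: imul_ideal.
  by rewrite andbT -mulrA => /hs [h1 h2]; do 2!apply: mem_imul => //.
Qed.

Lemma ipowS I n : ipow I n.+1 = imul I (ipow I n). Proof. by []. Qed.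
Lemma ipow0 I : ipow I 0 = @unit_ideal R. Proof. by []. Qed.

Lemma ipow_ideal I n : is_ideal I -> is_ideal (ipow I n).
Proof. by move=> hI; case: n => [|n] //; apply: imul_ideal. Qed.

Lemma ipow1 I : is_ideal I -> ipow I 1 = I.
Proof. by move=> hI; rewrite ipowS ipow0 imulC // imul1l. Qed.

Lemma ipowD I a b : is_ideal I -> ipow I (a + b) = imul (ipow I a) (ipow I b).
Proof.
move=> hI; elim: a => [|a IH]; first by rewrite imul1l //; apply: ipow_ideal.
by rewrite addSn !ipowS IH imulA //; apply: ipow_ideal.
Qed.

Lemma mem_ipowD I a b x y : is_ideal I ->
  ipow I a x -> ipow I b y -> ipow I (a + b) (x * y).
Proof. by move=> hI hx hy; rewrite ipowD //; apply: mem_imul. Qed.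

Lemma ipow_le I a b : is_ideal I -> (b <= a)%N -> isub (ipow I a) (ipow I b).
Proof.
move=> hI hab; rewrite -(subnK hab) ipowD //; apply: imul_subr.
exact: ipow_ideal.
Qed.

Lemma ipow_mono I J n : isub I J -> isub (ipow I n) (ipow J n).
Proof. by move=> h; elim: n => [|n IH] //; apply: imul_mono. Qed.

Lemma ipowM I a b : is_ideal I -> ipow (ipow I a) b = ipow I (a * b).
Proof.
move=> hI; elim: b => [|b IH]; first by rewrite muln0.
by rewrite ipowS IH mulnS -ipowD.
Qed.

Lemma mem_ipowX I h n x : is_ideal I -> ipow I h x -> ipow I (h * n) (x ^+ n).
Proof.
move=> hI hx; elim: n => [|n IH]; first by rewrite muln0.
by rewrite exprS mulnS; apply: mem_ipowD.
Qed.

Lemma mem_expr I n x : is_ideal I -> I x -> ipow I n (x ^+ n).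
Proof.
by move=> hI hx; rewrite -[n in ipow _ n]mul1n; apply: mem_ipowX; rewrite // ipow1.
Qed.

Lemma imul_suml I J K : is_ideal I -> is_ideal J -> is_ideal K ->
  imul (isum I J) K = isum (imul I K) (imul J K).
Proof.
move=> hI hJ hK; have hIK := imul_ideal K hI; have hJK := imul_ideal K hJ.
have hs : is_ideal (isum (imul I K) (imul J K)) by exact: isum_ideal.
apply: isub_antisym.
- apply: imul_sub => // x y [a [b [ha hb ->]]] hy; rewrite mulrDl.
  by exists (a * y), (b * y); split=> //; apply: mem_imul.
- apply: isum_sub; first by apply: imul_ideal; apply: isum_ideal.
    by apply: imul_mono => //; apply: isum_l.
  by apply: imul_mono => //; apply: isum_r.
Qed.

Lemma imul_prin y I x : is_ideal I -> imul (prin y) I x <-> exists2 r, I r & x = y * r.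
Proof.
move=> hI; split.
- suff: isub (imul (prin y) I) (fun x => exists2 r, I r & x = y * r) by apply.
  apply: imul_sub; last first.
    by move=> _ z [r ->] hz; exists (r * z); [apply: idMl | ring].
  split; first by exists 0; rewrite ?mulr0 //; apply: id0.
    move=> _ _ [r hr ->] [t ht ->].
    by exists (r + t); [apply: idD | rewrite mulrDr].
  by move=> a _ [r hr ->]; exists (a * r); [apply: idMl | ring].
- by move=> [r hr ->]; apply: mem_imul => //; apply: prin_mem.
Qed.

Lemma gen_nil : gen_ideal [::] = izero.
Proof.
apply: ideal_ext => x; split=> [[c ->]|->]; first by rewrite big_ord0.
by exists (fun=> 0); rewrite big_ord0.
Qed.

Lemma gen_cons y ys : gen_ideal (y :: ys) = isum (prin y) (gen_ideal ys).
Proof.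
apply: ideal_ext => x; split.
- move=> [c ->]; rewrite big_ord_recl /=; exists (c 0%N * y).
  exists (\sum_(i < size ys) c i.+1 * ys`_i); split=> //; first by exists (c 0%N).
  by exists (fun i => c i.+1).
- move=> [_ [_ [[r ->] [c ->] ->]]].
  exists (fun i => if i is i'.+1 then c i' else r).
  by rewrite big_ord_recl.
Qed.

Lemma gen_ideal_ideal ys : is_ideal (gen_ideal ys).
Proof.
elim: ys => [|y ys IH]; first by rewrite gen_nil; apply: izero_ideal.
by rewrite gen_cons; apply: isum_ideal => //; apply: prin_ideal.
Qed.

Lemma gen_mem ys y : y \in ys -> gen_ideal ys y.
Proof.
elim: ys => [|z ys IH] //; rewrite inE gen_cons => /orP[/eqP <-|/IH h].
  by apply: isum_l; [apply: gen_ideal_ideal | apply: prin_mem].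
by apply: isum_r => //; apply: prin_ideal.
Qed.

Lemma gen_sub ys K : is_ideal K -> (forall y, y \in ys -> K y) ->
  isub (gen_ideal ys) K.
Proof.
move=> hK; elim: ys => [|z ys IH] h.
  by rewrite gen_nil => x ->; apply: id0.
rewrite gen_cons; apply: isum_sub => //.
  by apply: prin_sub => //; apply: h; rewrite mem_head.
by apply: IH => y hy; apply: h; rewrite inE hy orbT.
Qed.

Lemma gen_cat ys zs : gen_ideal (ys ++ zs) = isum (gen_ideal ys) (gen_ideal zs).
Proof.
elim: ys => [|y ys IH] /=; last by rewrite !gen_cons IH isumA.
by rewrite gen_nil isumC isum0 //; apply: gen_ideal_ideal.
Qed.

Lemma gen1 y : gen_ideal [:: y] = prin y.
Proof. by rewrite gen_cons gen_nil isum0 //; apply: prin_ideal. Qed.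

Lemma imul_gen ys I x : is_ideal I ->
  imul (gen_ideal ys) I x ->
  exists c : nat -> R, (forall i, I (c i)) /\ x = \sum_(i < size ys) ys`_i * c i.
Proof.
move=> hI; elim: ys x => [|y ys IH] x.
  have : isub (imul (gen_ideal [::]) I) izero.
    apply: imul_sub; first exact: izero_ideal.
    by move=> a b; rewrite gen_nil => -> _; rewrite /izero mul0r.
  move=> h /h ->; exists (fun=> 0); split=> [i|]; first exact: id0.
  by rewrite big_ord0.
have hg := gen_ideal_ideal ys; have hp := prin_ideal y.
rewrite gen_cons imul_suml //.
move=> [_ [b [/(imul_prin _ _ hI) [r hr ->] /IH [c [hc ->]] ->]]].
exists (fun i => if i is i'.+1 then c i' else r); split; first by case.
by rewrite big_ord_recl.
Qed.

End Ideals.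
#[global] Hint Resolve isub_refl : core.
Arguments izero {R} : rename.
Arguments unit_ideal {R} : rename.

(** * Noetherian local rings and regular sequences *)

Section Noetherian.
Variable R : comNzRingType.
Implicit Types (I J K A B N : ideal R) (x y z : R) (s ys zs : seq R).

Lemma seq_bound (T : eqType) (P : nat -> T -> Prop) (s : seq T) :
  (forall n k (y : T), (n <= k)%N -> P n y -> P k y) ->
  (forall y : T, y \in s -> exists n, P n y) -> exists n, forall y : T, y \in s -> P n y.
Proof.
move=> mono; elim: s => [|y s IH] h; first by exists 0%N.
have [|n hn] := IH; first by move=> z hz; apply: h; rewrite inE hz orbT.
have [k hk] := h y (mem_head _ _).
exists (maxn n k) => z; rewrite inE => /orP[/eqP->|/hn hz].
  by apply: mono hk; apply: leq_maxr.
by apply: mono hz; apply: leq_maxl.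
Qed.

Lemma nat_bound (P : nat -> nat -> Prop) k :
  (forall n n' i, (n <= n')%N -> P n i -> P n' i) ->
  (forall i, (i < k)%N -> exists n, P n i) -> exists n, forall i, (i < k)%N -> P n i.
Proof.
move=> mono h; have [|n hn] := @seq_bound _ P (iota 0 k) mono.
  by move=> i; rewrite mem_iota => /h.
by exists n => i hi; apply: hn; rewrite mem_iota.
Qed.

Lemma chain_le (C : nat -> ideal R) : (forall n, isub (C n) (C n.+1)) ->
  forall n k, (n <= k)%N -> isub (C n) (C k).
Proof.
move=> hS n k hnk; rewrite -(subnK hnk); elim: (k - n)%N => [|j IH] //.
by apply: isub_trans IH _; apply: hS.
Qed.

Lemma chain_union_ideal (C : nat -> ideal R) : (forall n, is_ideal (C n)) ->
  (forall n, isub (C n) (C n.+1)) -> is_ideal (fun x => exists n, C n x).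
Proof.
move=> hC hS; have mono := chain_le hS; split.
- by exists 0%N; apply: id0.
- move=> x y [n hn] [k hk]; exists (maxn n k); apply: idD => //.
    by apply: mono hn; apply: leq_maxl.
  by apply: mono hk; apply: leq_maxr.
- by move=> a x [n hn]; exists n; apply: idMl.
Qed.

Hypothesis Rnoeth : is_noetherian R.

Lemma noeth_acc (C : nat -> ideal R) : (forall n, is_ideal (C n)) ->
  (forall n, isub (C n) (C n.+1)) -> exists n0, forall n, isub (C n) (C n0).
Proof.
move=> hC hS; have mono := chain_le hS.
have [s hs] := Rnoeth (chain_union_ideal hC hS).
have [||n0 hn0] := @seq_bound _ (fun n x => C n x) s.
- by move=> n k y hnk; apply: mono.
- by move=> y hy; apply/hs; apply: gen_mem.
exists n0 => n x hx; have /hs : exists n, C n x by exists n.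
by apply: gen_sub; first exact: hC.
Qed.

(** Without a maximal member, a choice function iterates to a strictly increasing chain, against
    [noeth_acc]. *)
Lemma noeth_max (P : ideal R -> Prop) J : (forall I, P I -> is_ideal I) -> P J ->
  exists2 M, P M & forall I, P I -> isub M I -> isub I M.
Proof.
move=> hid hJ; apply: NNPP => hno.
have next (I : {I | P I}) : exists I' : {I | P I},
    isub (sval I) (sval I') /\ ~ isub (sval I') (sval I).
  case: I => I hI /=; apply: NNPP => h; apply: hno; exists I => // I' hI' hs.
  by apply: NNPP => h'; apply: h; exists (exist _ I' hI').
pose f (I : {I | P I}) := sval (constructive_indefinite_description _ (next I)).
have hf (I : {I | P I}) : isub (sval I) (sval (f I)) /\ ~ isub (sval (f I)) (sval I).
  by rewrite /f; case: constructive_indefinite_description.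
pose C n := sval (iter n f (exist _ J hJ)).
have [n0 hn0] : exists n0, forall n, isub (C n) (C n0).
  apply: noeth_acc => n; last by case: (hf (iter n f (exist _ J hJ))).
  by apply: hid; rewrite /C; case: (iter n f _).
by case: (hf (iter n0 f (exist _ J hJ))) => _; apply; apply: (hn0 n0.+1).
Qed.

Variable m : ideal R.
Hypothesis mloc : is_local m.

Lemma local_ideal : is_ideal m. Proof. by case: mloc => -[[]]. Qed.
Lemma local_proper : ~ m 1. Proof. by case: mloc => -[[]]. Qed.

Lemma local_unit x : ~ m x -> exists y, y * x = 1.
Proof.
move=> hx; apply: NNPP => hno.
have hp : is_proper_ideal (prin x).
  split; first exact: prin_ideal.
  by move=> [r hr]; apply: hno; exists r.
have [||M [hM hxM] hmax] := @noeth_max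
    (fun J => is_proper_ideal J /\ isub (prin x) J) (prin x) => //.
  by move=> I [[]].
have Mmax : is_maximal_ideal M.
  split=> // J hJ hMJ; apply: hmax => //; split=> //.
  exact: isub_trans hxM hMJ.
by case: mloc => _ /(_ M Mmax) h; apply/hx/h/hxM/prin_mem.
Qed.

Lemma local_mulN x y : ~ m x -> ~ m y -> ~ m (x * y).
Proof.
move=> /local_unit [a ha] /local_unit [b hb] h; apply: local_proper.
rewrite -(mulr1 1) -{1}ha -hb; have -> : a * x * (b * y) = a * b * (x * y) by ring.
exact: idMl local_ideal h.
Qed.

Lemma local_1B x : m x -> ~ m (1 - x).
Proof.
move=> hx h; apply: local_proper; rewrite -(subrK x 1).
exact: idD local_ideal h hx.
Qed.

Lemma local_cancel I x y : is_ideal I -> ~ m x -> I (x * y) -> I y.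
Proof.
move=> hI /local_unit [a ha] h; rewrite -(mul1r y) -ha -mulrA.
exact: idMl.
Qed.

(** The generators of [N] are discarded one at a time: modulo [A] and the later ones, [g] equals
    [d * g] with [d] in [m], and [1 - d] is a unit. *)
Lemma nakayama A N : is_ideal A -> is_ideal N ->
  isub N (isum A (imul m N)) -> isub N A.
Proof.
move=> hA hN hsub; have hm := local_ideal.
have [gs hgs] := Rnoeth hN.
have key s : {subset s <= gs} -> isub N (isum A (gen_ideal s)) -> isub N A.
  elim: s => [|g s IH] hs hNs; first by move: hNs; rewrite gen_nil isum0.
  apply: IH; first by move=> x hx; apply: hs; rewrite inE hx orbT.
  have hgi := gen_ideal_ideal s; have hT : is_ideal (isum A (gen_ideal s)).
    exact: isum_ideal.
  have hNs' : isub N (isum (isum A (gen_ideal s)) (prin g)).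
    apply: isub_trans hNs _; rewrite gen_cons -isumA [X in isum A X]isumC.
    exact: isub_refl.
  suff hg : isum A (gen_ideal s) g.
    by apply: isub_trans hNs' _; apply: isum_sub => //; apply: prin_sub.
  have hmN : isub (imul m N)
      (fun x => exists a b, [/\ isum A (gen_ideal s) a, m b & x = a + b * g]).
    apply: imul_sub.
      split.
      - by exists 0, 0; rewrite mul0r addr0; split=> //; apply: id0.
      - move=> _ _ [a [b [ha hb ->]]] [c [d [hc hd ->]]].
        exists (a + c), (b + d).
        by split; [apply: idD|apply: idD|rewrite mulrDl addrACA].
      - move=> r _ [a [b [ha hb ->]]]; exists (r * a), (r * b).
        by split; [apply: idMl|apply: idMl|rewrite mulrDr mulrA].
    move=> x y hx /hNs' [a [_ [ha [r ->] ->]]]; exists (x * a), (x * r).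
    by split; [apply: idMl|apply: idMr|rewrite mulrDr mulrA].
  have /hsub [a [b [ha /hmN [c [d [hc hd ->]]] e]]] : N g.
    by apply/hgs/gen_mem/hs/mem_head.
  apply: (@local_cancel _ (1 - d)) => //; first exact: local_1B.
  have -> : (1 - d) * g = a + c by rewrite mulrBl mul1r {1}e; ring.
  by apply: idD => //; apply: isum_l.
apply: (key gs) => // x /hgs; exact: isum_r.
Qed.

Definition nzd A y := forall r, A (y * r) -> A r.

(** The base ideal [A] is a parameter, so that a prefix of the sequence can be absorbed into it and
    inductions run along the list. *)
Fixpoint reg A ys :=
  if ys is y :: ys' then nzd A y /\ reg (isum A (prin y)) ys' else True.

Lemma reg_cat A ys zs : is_ideal A ->
  reg A (ys ++ zs) <-> reg A ys /\ reg (isum A (gen_ideal ys)) zs.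
Proof.
elim: ys A => [|y ys IH] A hA /=; first by rewrite gen_nil isum0 //; tauto.
rewrite IH; last by apply: isum_ideal => //; apply: prin_ideal.
by rewrite gen_cons isumA; tauto.
Qed.

(* Nakayama applied to the ideal (A : b): if a is regular modulo A, then
   (A : b) is contained in A + a (A : b). *)
Lemma nzd_swap A a b : is_ideal A -> m a -> nzd A a -> nzd (isum A (prin a)) b ->
  nzd A b /\ nzd (isum A (prin b)) a.
Proof.
move=> hA ha hna hnb; split.
- have hN : is_ideal (fun r => A (b * r)).
    split; first by rewrite mulr0; apply: id0.
      by move=> x y hx hy; rewrite mulrDr; apply: idD.
    by move=> r x hx; rewrite mulrCA; apply: idMl.
  apply: (nakayama hA hN) => r hr.
  have [c [_ [hc [t ->] e]]] : isum A (prin a) r.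
    by apply: hnb; apply: isum_l hr; apply: prin_ideal.
  exists c, (a * t); split=> //; last by rewrite e mulrC.
  apply: mem_imul => //; apply: hna.
  have -> : a * (b * t) = b * r - b * c by rewrite e; ring.
  by apply: idB => //; apply: idMl.
- move=> r [c [_ [hc [t ->] e]]].
  have [d [_ [hd [u ->] e']]] : isum A (prin a) t.
    apply: hnb; exists (- c), (r * a); split; first exact: idN.
      by exists r.
    by rewrite [r * a]mulrC e; ring.
  exists (r - u * b), (u * b); split; last by rewrite subrK.
    apply: hna; have -> : a * (r - u * b) = c + d * b.
      by rewrite mulrBr e e'; ring.
    by apply: idD => //; apply: idMr.
  by exists u.
Qed.

Lemma isum_ac A x y : isum (isum A (prin x)) (prin y) = isum (isum A (prin y)) (prin x).
Proof. by rewrite -!isumA [X in isum A X]isumC. Qed.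

(** Repeated [nzd_swap], which wants the first element of each pair in [m]: here these are the
    elements of [zs], overtaken by [y]; in the converse direction below it is [y] alone. *)
Lemma reg_rcons_cons A zs y : is_ideal A -> (forall z, z \in zs -> m z) ->
  reg A (rcons zs y) -> reg A (y :: zs).
Proof.
elim: zs A => [|z zs IH] A hA hz //= [h1 h2].
have [||hy hr] := IH (isum A (prin z)) _ _ h2.
- by apply: isum_ideal => //; apply: prin_ideal.
- by move=> x hx; apply: hz; rewrite inE hx orbT.
have [h3 h4] := nzd_swap hA (hz z (mem_head _ _)) h1 hy.
by split=> //; split=> //; rewrite isum_ac.
Qed.

Lemma reg_cons_rcons A zs y : is_ideal A -> m y ->
  reg A (y :: zs) -> reg A (rcons zs y).
Proof.
move=> + hy; elim: zs A => [|z zs IH] A hA //= [h1 [h2 h3]].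
have [h4 h5] := nzd_swap hA hy h1 h2.
split=> //; apply: IH; first by apply: isum_ideal => //; apply: prin_ideal.
by split=> //; rewrite isum_ac.
Qed.

Lemma nzd_exp A y n : nzd A y -> nzd A (y ^+ n).
Proof.
move=> h; elim: n => [|n IH] r; first by rewrite mul1r.
by rewrite exprSr -mulrA => /IH /h.
Qed.

Lemma reg_last_exp A ys y n : is_ideal A ->
  reg A (rcons ys y) -> reg A (rcons ys (y ^+ n)).
Proof.
move=> hA; rewrite -!cats1 !reg_cat //= => -[h1 [h2 _]]; split=> //; split=> //.
exact: nzd_exp.
Qed.

(** Taking a power is harmless in the last position, by [nzd_exp]; so each term is rotated to the
    end and raised there. In [key], [zs] collects the powers already made. *)
Lemma reg_exp A ys n : is_ideal A -> (forall y, y \in ys -> m y) -> (0 < n)%N ->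
  reg A ys -> reg A [seq y ^+ n | y <- ys].
Proof.
move=> hA + n0; have mn y : m y -> m (y ^+ n).
  by move=> hy; rewrite -(prednK n0) exprSr; apply: idMl local_ideal _.
suff key zs : (forall y, y \in ys -> m y) ->
    reg A (ys ++ zs) -> reg A (zs ++ [seq y ^+ n | y <- ys]).
  by move=> hy h; have := key [::] hy; rewrite cats0; apply.
elim: ys zs => [|y ys IH] zs hy; first by rewrite cats0.
move=> h; rewrite /= -cat_rcons; apply: IH.
  by move=> z hz; apply: hy; rewrite inE hz orbT.
rewrite -rcons_cat; apply: reg_last_exp => //.
by apply: reg_cons_rcons => //; apply: hy; rewrite mem_head.
Qed.

Lemma regular_seq_reg ys : regular_seq ys -> reg izero ys.
Proof.
case=> h _; rewrite -gen_nil.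
suff key pre zs : (forall i, (i < size zs)%N -> forall y,
    gen_ideal (pre ++ take i zs) (zs`_i * y) -> gen_ideal (pre ++ take i zs) y) ->
    reg (gen_ideal pre) zs by exact: key.
elim: zs pre => [|z zs IH] pre hz //=; split.
  by move=> r; have := hz 0%N isT r; rewrite take0 cats0.
rewrite -gen1 -gen_cat; apply: IH => i hi y.
by rewrite -catA; apply: (hz i.+1).
Qed.

End Noetherian.

(** * Length of subquotients *)

Section Length.
Variable R : comNzRingType.
Implicit Types V W : lmodType R.

Definition submod V (M : V -> Prop) : Prop :=
  [/\ M 0, (forall x y, M x -> M y -> M (x + y)) & (forall a x, M x -> M (a *: x))].
Definition msub V (M N : V -> Prop) : Prop := forall x, M x -> N x.
Definition mcap V (M N : V -> Prop) : V -> Prop := fun x => M x /\ N x.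
Definition madd V (M N : V -> Prop) : V -> Prop :=
  fun x => exists a b, [/\ M a, N b & x = a + b].

Lemma mset_ext V (M N : V -> Prop) : msub M N -> msub N M -> M = N.
Proof.
move=> h1 h2; apply: functional_extensionality => x.
by apply: propositional_extensionality; split=> [/h1|/h2].
Qed.

Lemma submodB V (M : V -> Prop) x y : submod M -> M x -> M y -> M (x - y).
Proof. by case=> _ hD hZ hx hy; apply: hD => //; rewrite -scaleN1r; apply: hZ. Qed.

Lemma submod_cap V (M N : V -> Prop) : submod M -> submod N -> submod (mcap M N).
Proof.
move=> [m0 mD mZ] [n0 nD nZ]; split=> //.
  by move=> x y [? ?] [? ?]; split; [apply: mD|apply: nD].
by move=> a x [? ?]; split; [apply: mZ|apply: nZ].
Qed.

Lemma submod_add V (M N : V -> Prop) : submod M -> submod N -> submod (madd M N).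
Proof.
move=> [m0 mD mZ] [n0 nD nZ]; split.
- by exists 0, 0; rewrite addr0.
- move=> _ _ [a [b [ha hb ->]]] [c [d [hc hd ->]]]; exists (a + c), (b + d).
  by split; [apply: mD|apply: nD|rewrite addrACA].
- move=> r _ [a [b [ha hb ->]]]; exists (r *: a), (r *: b).
  by split; [apply: mZ|apply: nZ|rewrite scalerDr].
Qed.

Lemma madd_subl V (M N : V -> Prop) : submod N -> msub M (madd M N).
Proof. by case=> n0 _ _ x hx; exists x, 0; rewrite addr0. Qed.
Lemma madd_subr V (M N : V -> Prop) : submod M -> msub N (madd M N).
Proof. by case=> n0 _ _ x hx; exists 0, x; rewrite add0r. Qed.
Lemma madd_sub V (M N L : V -> Prop) : submod L -> msub M L -> msub N L ->
  msub (madd M N) L.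
Proof. by move=> [_ hD _] h1 h2 x [a [b [/h1 ha /h2 hb ->]]]; apply: hD. Qed.

Lemma madd_mono V (M M' N : V -> Prop) : msub M M' -> msub (madd M N) (madd M' N).
Proof. by move=> h x [a [b [/h ha hb ->]]]; exists a, b. Qed.

(** Says that $N/M$ has length at least [n]. The chain may stop strictly inside [N], which makes
    enlarging [N] and shrinking [M] immediate. *)
Fixpoint lge V n (M N : V -> Prop) : Prop :=
  if n is n'.+1 then exists M', [/\ submod M', msub M M',
    (exists2 x, M' x & ~ M x) & lge n' M' N] else msub M N.

Definition has_len V (M N : V -> Prop) n := lge n M N /\ ~ lge n.+1 M N.

Lemma lge_weakl V n (M0 M N : V -> Prop) : msub M0 M -> lge n M N -> lge n M0 N.
Proof.
move=> h; case: n => [|n] /=; first by move=> h2 x /h/h2.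
move=> [M' [h1 h2 [x hx hx'] h4]]; exists M'; split=> //; first by move=> y /h/h2.
by exists x => // /h.
Qed.

Lemma lge_weakr V n (M N N' : V -> Prop) : msub N N' -> lge n M N -> lge n M N'.
Proof.
move=> h; elim: n M => [|n IH] M /=; first by move=> h2 x /h2/h.
by move=> [M' [h1 h2 h3 /IH h4]]; exists M'.
Qed.

Lemma lge_pred V n (M N : V -> Prop) : lge n.+1 M N -> lge n M N.
Proof. by move=> [M' [_ h _]]; apply: lge_weakl. Qed.

Lemma lge_le V n k (M N : V -> Prop) : (k <= n)%N -> lge n M N -> lge k M N.
Proof.
move=> hk; rewrite -(subnK hk); elim: (n - k)%N => [|j IH] //.
by rewrite addSn => /lge_pred.
Qed.

Lemma lge_sub V n (M N : V -> Prop) : lge n M N -> msub M N.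
Proof. exact: (@lge_le _ n 0). Qed.

Lemma lge_cat V a b (M N L : V -> Prop) : lge a M N -> lge b N L -> lge (a + b) M L.
Proof.
elim: a M => [|a IH] M /=; first exact: lge_weakl.
by move=> [M' [h1 h2 h3 /IH h4]] /h4 h5; exists M'.
Qed.

(* By the modular law, a strict inclusion M < M' stays strict after
   intersecting with N or after adding N. *)
Lemma lge_split V n (M N L : V -> Prop) : submod M -> submod N -> lge n M L ->
  exists a b, [/\ (a + b = n)%N, lge a (mcap M N) (mcap L N) &
    lge b (madd M N) (madd L N)].
Proof.
move=> hM hN; elim: n M hM => [|n IH] M hM.
  move=> h; exists 0%N, 0%N; split=> // [x [/h hx hx']|] //; exact: madd_mono.
move=> [M' [hM' hs [x hx hxM] /(IH _ hM') [a [b [<- ha hb]]]]].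
have s1 : msub (mcap M N) (mcap M' N) by move=> y [/hs].
have s2 := madd_mono (N := N) hs.
case: (classic (exists2 y, mcap M' N y & ~ mcap M N y)) => hy.
  exists a.+1, b; split=> //; last exact: lge_weakl hb.
  by exists (mcap M' N); split=> //; apply: submod_cap.
exists a, b.+1; split; first by rewrite addnS.
  exact: lge_weakl ha.
exists (madd M' N); split=> //; first exact: submod_add.
exists x; first exact: madd_subl.
move=> [y [z [hy' hz e]]]; apply: hxM; rewrite e.
case: hM => _ hD _; apply: hD => //; apply: NNPP => hz'.
apply: hy; exists z; last by case.
split=> //; rewrite (_ : z = x - y); last by rewrite e addrAC subrr add0r.
by apply: submodB => //; apply: hs.
Qed.

Lemma has_len_uniq V (M N : V -> Prop) a b : has_len M N a -> has_len M N b -> a = b.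
Proof.
move=> [h1 h2] [h3 h4]; apply/eqP; rewrite eqn_leq; apply/andP; split.
  by rewrite leqNgt; apply/negP => h; apply: h4; apply: lge_le h1.
by rewrite leqNgt; apply/negP => h; apply: h2; apply: lge_le h3.
Qed.

Lemma lge_has_len V n (M N : V -> Prop) : msub M N -> ~ lge n M N ->
  exists k, has_len M N k.
Proof.
move=> h; elim: n => [|n IH] hn //.
by case: (classic (lge n M N)) => [h'|/IH //]; exists n.
Qed.

(** A chain of [(a + b).+1] steps from [M] to [L], cut along [N] by [lge_split], would exceed [a]
    below [N] or [b] above it. *)
Lemma has_len_add V (M N L : V -> Prop) a b : submod M -> submod N -> submod L ->
  has_len M N a -> has_len N L b -> has_len M L (a + b).
Proof.
move=> hM hN hL [ha ha'] [hb hb']; split; first exact: lge_cat ha hb.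
have s1 := lge_sub ha; have s2 := lge_sub hb.
move=> /(lge_split hM hN) [c [d [e hc hd]]].
have eM : mcap M N = M by apply: mset_ext => x; [case | split=> //; apply: s1].
have eL : mcap L N = N by apply: mset_ext => x; [case | split=> //; apply: s2].
have eM' : madd M N = N by apply: mset_ext; [exact: madd_sub | exact: madd_subr].
have eL' : madd L N = L by apply: mset_ext; [exact: madd_sub | exact: madd_subl].
rewrite eM eL in hc; rewrite eM' eL' in hd.
case: (leqP c a) => hca; last by apply: ha'; apply: lge_le hc.
by apply: hb'; apply: lge_le hd; lia.
Qed.

Lemma has_len_split V (M N L : V -> Prop) c : submod M -> submod N -> submod L ->
  msub M N -> msub N L -> has_len M L c ->
  exists a b, [/\ has_len M N a, has_len N L b & c = (a + b)%N].
Proof.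
move=> hM hN hL s1 s2 hc; have [h h'] := hc.
have [a ha] : exists a, has_len M N a.
  by apply: (@lge_has_len _ c.+1) => // /(lge_weakr s2).
have [b hb] : exists b, has_len N L b.
  by apply: (@lge_has_len _ c.+1) => // /(lge_weakl s1).
by exists a, b; split=> //; apply: has_len_uniq hc (has_len_add hM hN hL ha hb).
Qed.

Lemma has_len0 V (M : V -> Prop) : has_len M M 0.
Proof. by split=> // -[M' [_ h [x hx hx'] h2]]; apply/hx'/h2. Qed.

Lemma has_len0_eq V (M N : V -> Prop) : submod N -> has_len M N 0 -> M = N.
Proof.
move=> hN [s h]; apply: mset_ext => // x hx; apply: NNPP => hx'.
by apply: h; exists N; split=> //; exists x.
Qed.

Lemma has_len_subr V (M N N' : V -> Prop) c : submod M -> submod N -> submod N' ->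
  msub M N -> msub N N' -> has_len M N' c -> exists2 a, has_len M N a & (a <= c)%N.
Proof.
move=> h1 h2 h3 h4 h5 /(has_len_split h1 h2 h3 h4 h5) [a [b [ha _ ->]]].
by exists a => //; apply: leq_addr.
Qed.

Lemma has_len_subl V (M M' N : V -> Prop) c : submod M -> submod M' -> submod N ->
  msub M M' -> msub M' N -> has_len M N c -> exists2 a, has_len M' N a & (a <= c)%N.
Proof.
move=> h1 h2 h3 h4 h5 /(has_len_split h1 h2 h3 h4 h5) [a [b [_ hb ->]]].
by exists b => //; apply: leq_addl.
Qed.

(** * Length under a linear map *)

Section Preimage.
Variables (V W : lmodType R) (f : {linear V -> W}) (L : V -> Prop).
Hypothesis hL : submod L.

Definition mpre (M : W -> Prop) : V -> Prop := fun x => L x /\ M (f x).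
Definition mimg (M : W -> Prop) : (V -> Prop) -> W -> Prop := fun A y =>
  exists x z, [/\ A x, M z & y = f x + z].

Lemma mpre_submod M : submod M -> submod (mpre M).
Proof.
case: hL => l0 lD lZ [m0 mD mZ]; split; first by rewrite /mpre linear0.
  by move=> x y [? ?] [? ?]; split; [apply: lD|rewrite linearD; apply: mD].
by move=> a x [? ?]; split; [apply: lZ|rewrite linearZ; apply: mZ].
Qed.

Lemma mimg_submod M A : submod M -> submod A -> submod (mimg M A).
Proof.
move=> [m0 mD mZ] [a0 aD aZ]; split; first by exists 0, 0; rewrite linear0 addr0.
  move=> _ _ [a [b [ha hb ->]]] [c [d [hc hd ->]]]; exists (a + c), (b + d).
  by split; [apply: aD|apply: mD|rewrite linearD addrACA].
move=> r _ [a [b [ha hb ->]]]; exists (r *: a), (r *: b).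
by split; [apply: aZ|apply: mZ|rewrite linearZ scalerDr].
Qed.

Lemma lge_img M n A : submod M -> submod A -> msub (mpre M) A ->
  lge n A L -> lge n (mimg M A) (mimg M L).
Proof.
move=> hM; elim: n A => [|n IH] A hA hs /=.
  by move=> h _ [x [z [/h hx hz ->]]]; exists x, z.
move=> [A' [hA' hAA [x hx hxA] h]]; exists (mimg M A'); split.
- exact: mimg_submod.
- by move=> _ [y [z [/hAA hy hz ->]]]; exists y, z.
- exists (f x); first by exists x, 0; rewrite addr0; split=> //; case: hM.
  move=> [y [z [hy hz e]]]; apply: hxA.
  suff hxy : A (x - y) by rewrite -(subrK y x); case: hA => _ aD _; apply: aD.
  apply: hs; split; last by rewrite linearB e addrAC subrr add0r.
  have sL := lge_sub h; apply: submodB => //; first exact: sL.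
  by apply/sL/hAA.
- by apply: IH => // y /hs /hAA.
Qed.

Lemma lge_pre M n B : submod M -> submod B -> msub M B ->
  lge n B (mimg M L) -> lge n (mpre B) L.
Proof.
move=> hM; elim: n B => [|n IH] B hB hs /=; first by move=> _ x [].
move=> [B' [hB' hBB [y hy hyB] h]]; exists (mpre B'); split.
- exact: mpre_submod.
- by move=> x [hx /hBB].
- have [x [z [hx hz e]]] := lge_sub h hy; exists x.
    split=> //; rewrite (_ : f x = y - z); last by rewrite e addrK.
    by apply: submodB => //; apply/hBB/hs.
  move=> [_ hfx]; apply: hyB; rewrite e; case: hB => _ bD _; apply: bD => //.
  exact: hs.
- by apply: IH => // x /hs /hBB.
Qed.

(** The isomorphism $L/(L\cap f^{-1}(M))\cong (f(L)+M)/M$, read off on chains so that no quotient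
    module has to be formed. *)
Lemma has_len_pre M n : submod M ->
  has_len (mpre M) L n <-> has_len M (mimg M L) n.
Proof.
move=> hM; have hP := mpre_submod hM.
have eI : mimg M (mpre M) = M.
  have [m0 mD _] := hM; apply: mset_ext.
    by move=> _ [x [z [[_ hx] hz ->]]]; apply: mD.
  by move=> z hz; exists 0, z; rewrite linear0 add0r; split=> //; case: hP.
have key k : lge k (mpre M) L <-> lge k M (mimg M L).
  by split=> [/(lge_img hM hP)|]; [rewrite eI; apply | apply: lge_pre].
by rewrite /has_len !key.
Qed.

End Preimage.

Definition mprod V W (M : V -> Prop) (N : W -> Prop) : V * W -> Prop :=
  fun p => M p.1 /\ N p.2.
Definition mfull V : V -> Prop := fun=> True.

Lemma mfull_submod V : submod (@mfull V). Proof. by []. Qed.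

Lemma mprod_submod V W (M : V -> Prop) (N : W -> Prop) :
  submod M -> submod N -> submod (mprod M N).
Proof.
move=> [m0 mD mZ] [n0 nD nZ]; split=> //.
  by move=> x y [? ?] [? ?]; split; [apply: mD|apply: nD].
by move=> a x [? ?]; split; [apply: mZ|apply: nZ].
Qed.

Definition inr_lin V W (w : W) : V * W := (0, w).
Lemma inr_lin_linear V W : linear (@inr_lin V W).
Proof.
by move=> a x y; rewrite /inr_lin; congr pair; rewrite /= scaler0 addr0.
Qed.
HB.instance Definition _ V W :=
  GRing.isLinear.Build R W (V * W)%type _ (@inr_lin V W) (@inr_lin_linear V W).

(** Filter by $M\times N\subseteq M\times W\subseteq V\times W$: [has_len_pre] treats the lower step
    through [inr_lin] and the upper one through [fst]. *)
Lemma has_len_prod V W (M : V -> Prop) (N : W -> Prop) a b :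
  submod M -> submod N -> has_len M (@mfull V) a -> has_len N (@mfull W) b ->
  has_len (mprod M N) (@mfull (V * W)%type) (a + b).
Proof.
move=> hM hN ha hb; rewrite addnC.
have hMN := mprod_submod hM hN; have hMW := mprod_submod hM (mfull_submod W).
apply: (@has_len_add _ _ (mprod M (@mfull W))) => //.
  have e1 : mpre (@inr_lin V W) (@mfull W) (mprod M N) = N.
    by apply: mset_ext => x; [case=> _ [] | move=> hx; split=> //; split=> //; case: hM].
  have e2 : mimg (@inr_lin V W) (mprod M N) (@mfull W) = mprod M (@mfull W).
    apply: mset_ext => [_ [x [z [_ [h1 h2] ->]]]|[v w] [hv _]].
      by split=> //=; rewrite add0r.
    exists w, (v, 0); split=> //; first by split=> //=; case: hN.
    by congr pair; rewrite ?add0r ?addr0.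
  by rewrite -e2; apply/has_len_pre => //; rewrite e1.
have e1 : mpre fst (@mfull (V * W)%type) M = mprod M (@mfull W).
  by apply: mset_ext => x []; split.
have e2 : mimg fst M (@mfull (V * W)%type) = @mfull V.
  apply: mset_ext => // v _; exists (v, 0), 0; split=> //=; first by case: hM.
  by rewrite addr0.
by rewrite -e1; apply/has_len_pre => //; rewrite e2.
Qed.

End Length.

(** * Lengths modulo ideals *)

Section IdealLength.
Variable R : comNzRingType.
Implicit Types (I J K A B N Q : ideal R) (x y z : R) (s ys zs : seq R).

Definition ilen I J n := @has_len R R^o I J n.

Lemma submod_ideal I : is_ideal I -> @submod R R^o I.
Proof. by []. Qed.
Hint Resolve submod_ideal : core.

Lemma ilen_add A B N a b : is_ideal A -> is_ideal B -> is_ideal N ->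
  ilen A B a -> ilen B N b -> ilen A N (a + b).
Proof. exact: (@has_len_add R R^o). Qed.

Lemma ilen_split A B N c : is_ideal A -> is_ideal B -> is_ideal N ->
  isub A B -> isub B N -> ilen A N c ->
  exists a b, [/\ ilen A B a, ilen B N b & c = (a + b)%N].
Proof. exact: (@has_len_split R R^o). Qed.

Lemma ilen_uniq A B a b : ilen A B a -> ilen A B b -> a = b.
Proof. exact: has_len_uniq. Qed.

Lemma ilen0 A : ilen A A 0. Proof. exact: has_len0. Qed.

Lemma length_quot_ilen I n : is_ideal I -> length_quot I n -> ilen I unit_ideal n.
Proof.
move=> hI [[C [/ideal_ext e0 [/ideal_ext en [hid hst]]]] hmax].
(* [lge] may stop below the whole ring, whereas [ideal_chain] must end there; the conversion then
   adds a step, hence [k <= k']. *)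
have toC k A : lge (V := R^o) k A unit_ideal -> is_ideal A ->
    exists C k', (k <= k')%N /\ ideal_chain A C k'.
  elim: k A => [|k IH] A /=.
    move=> _ hA; case: (classic (isub unit_ideal A)) => h.
      have -> : A = unit_ideal by apply: isub_antisym.
      by exists (fun=> unit_ideal), 0%N.
    exists (fun i => if i is 0%N then A else unit_ideal), 1%N.
    split=> //; split; first by move=> x; split.
    split; first by move=> x; split.
    split; first by case.
    by case=> // _; split.
  move=> [A' [hA' hs [x hx hx'] /IH/(_ hA') [C' [k' [hk [h1 [h2 [h3 h4]]]]]]]] hA.
  exists (fun i => if i is i'.+1 then C' i' else A), k'.+1.
  split=> //; split=> //; split=> //; split; first by case.
  case=> [|i] //= hi; last exact: h4.
  rewrite (ideal_ext h1); split=> // h; exact/hx'/h.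
split.
  rewrite -{1}e0 -{1}en.
  have: forall j, (j <= n)%N -> lge (V := R^o) j (C (n - j)%N) (C n).
    elim=> [|j IH] hj; first by rewrite subn0.
    exists (C (n - j)%N); have e : (n - j = (n - j.+1).+1)%N by lia.
    have [h1 h2] : iproper_sub (C (n - j.+1)%N) (C (n - j.+1).+1).
      by apply: hst; lia.
    rewrite -e in h1 h2; split=> //; last by apply: IH; lia.
      by apply: hid; lia.
    apply: NNPP => h; apply: h2 => x hx; apply: NNPP => h'.
    by apply: h; exists x.
  by move=> /(_ n (leqnn n)); rewrite subnn.
move=> /toC /(_ hI) [C' [k' [hk /hmax]]]; lia.
Qed.

Definition mull (y : R) (x : R^o) : R^o := y * x.
Lemma mull_linear y : linear (mull y).
Proof. by move=> a u v; rewrite /mull mulrDr /GRing.scale /= mulrCA. Qed.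
HB.instance Definition _ y :=
  GRing.isLinear.Build R R^o R^o _ (mull y) (mull_linear y).

Lemma colon_ideal A B y : is_ideal A -> is_ideal B ->
  is_ideal (fun x => B x /\ A (y * x)).
Proof. by move=> hA hB; apply: (@mpre_submod R R^o R^o (mull y)). Qed.

(** Multiplication by [y] maps [B] onto $(yB+A)/A$ with kernel $B\cap(A:y)$. *)
Lemma ilen_colon A B y n : is_ideal A -> is_ideal B ->
  ilen (fun x => B x /\ A (y * x)) B n <-> ilen A (isum (imul (prin y) B) A) n.
Proof.
move=> hA hB; rewrite /ilen.
have -> : isum (imul (prin y) B) A = mimg (mull y) A B.
  apply: isub_antisym => z.
    by move=> [_ [c [/(imul_prin _ _ hB) [r hr ->] hc ->]]]; exists r, c.
  move=> [r [c [hr hc ->]]]; exists (y * r), c; split=> //.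
  by apply/imul_prin => //; exists r.
by rewrite -(@has_len_pre R R^o R^o (mull y) B).
Qed.

Lemma imulCA A B N : is_ideal A -> is_ideal B -> is_ideal N ->
  imul A (imul B N) = imul B (imul A N).
Proof. by move=> hA hB hN; rewrite !imulA // (imulC hA). Qed.

Lemma ipow_reduction A B k j : is_ideal A -> is_ideal B ->
  ipow A k.+1 = imul B (ipow A k) ->
  isub (ipow A (j + k)) (imul (ipow B j) (ipow A k)).
Proof.
move=> hA hB e; have hAk n := ipow_ideal n hA; have hBk n := ipow_ideal n hB.
elim: j => [|j IH]; first by rewrite imul1l.
rewrite addSn ipowS; apply: isub_trans (imul_mono (isub_refl (I := A)) IH) _.
by rewrite imulCA // -ipowS e imulA // [ipow B j.+1]ipowS (imulC hB).
Qed.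

(** Separates the products with a factor from [A] from those with none; for principal [A] this
    drives the inductions on the number of generators. *)
Lemma ipow_isumS A B n : is_ideal A -> is_ideal B ->
  ipow (isum A B) n.+1 = isum (ipow B n.+1) (imul A (ipow (isum A B) n)).
Proof.
move=> hA hB; have hS := isum_ideal hA hB; have hP k := ipow_ideal k hS.
have hPB k := ipow_ideal k hB.
have hAP k : is_ideal (imul A (ipow (isum A B) k)) by exact: imul_ideal.
apply: isub_antisym; last first.
  apply: isum_sub => //; first by apply: ipow_mono; apply: isum_r.
  by rewrite ipowS; apply: imul_mono => //; apply: isum_l.
elim: n => [|n IH]; rewrite ipowS imul_suml //.
  rewrite isumC !ipow0; apply: isum_mono => //; exact: isub_refl.
apply: isum_sub; first exact: isum_ideal; first exact: isum_r.
have hT : is_ideal (isum (ipow B n.+2) (imul A (ipow (isum A B) n.+1))).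
  exact: isum_ideal.
apply: imul_sub => // b u hb /IH [p [q [hp hq ->]]]; rewrite mulrDr.
exists (b * p), (b * q); split=> //; first by rewrite ipowS; apply: mem_imul.
rewrite ipowS; apply: (imul_mono (I := A) (J := imul B (ipow (isum A B) n))) => //.
  by apply: imul_mono => //; apply: isum_r.
by rewrite imulCA //; apply: mem_imul.
Qed.

(** The binomial counts monomials of degree below [n]. Pascal's rule: with $Q$ the ideal of
    [y :: ys], multiplication by [y] maps $R/(A+Q^n)$ onto the part of $R/(A+Q^{n+1})$ generated by
    [y], and the cokernel belongs to the shorter list over $A+(y)$. *)
Lemma ilen_ipow_gen A ys l : is_ideal A -> ilen (isum A (gen_ideal ys)) unit_ideal l ->
  forall n, exists2 a, ilen (isum A (ipow (gen_ideal ys) n)) unit_ideal a &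
    (a <= l * 'C((n + size ys).-1, size ys))%N.
Proof.
have hT := @unit_ideal_ideal R.
elim: ys A => [|y ys IHy] A hA hl n.
  case: n => [|n].
    exists 0%N => //; rewrite ipow0 (_ : isum A unit_ideal = unit_ideal); first exact: ilen0.
    by apply: isub_antisym => //; apply: isum_r.
  exists l; last by rewrite bin0 muln1.
  rewrite gen_nil isum0 // in hl.
  rewrite gen_nil (_ : ipow izero n.+1 = izero) ?isum0 //.
  rewrite ipowS; apply: isub_antisym; first by apply: imul_subl; apply: izero_ideal.
  by move=> x ->; apply: id0; apply: imul_ideal; apply: izero_ideal.
have hp := prin_ideal y; have hg := gen_ideal_ideal ys.
have hAp := isum_ideal hA hp.
have hQ k : is_ideal (ipow (gen_ideal (y :: ys)) k).
  by apply: ipow_ideal; apply: gen_ideal_ideal.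
elim: n => [|n [a ha hab]].
  exists 0%N => //; rewrite ipow0 (_ : isum A unit_ideal = unit_ideal); first exact: ilen0.
  by apply: isub_antisym => //; apply: isum_r.
rewrite gen_cons isumA in hl.
have [b hb hbb] := IHy _ hAp hl n.+1.
set A0 := isum A (ipow (gen_ideal (y :: ys)) n.+1).
have hA0 : is_ideal A0 by exact: isum_ideal.
have eN : isum (isum A (prin y)) (ipow (gen_ideal ys) n.+1) =
    isum (imul (prin y) unit_ideal) A0.
  have ep : imul (prin y) unit_ideal = prin y by rewrite imulC // imul1l.
  have hg1 := ipow_ideal n.+1 hg.
  have hQQ : isub (ipow (gen_ideal ys) n.+1) A0.
    apply: isub_trans (isum_r _) => //; apply: ipow_mono; rewrite gen_cons.
    exact: isum_r.
  rewrite ep; apply: isub_antisym.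
    do !(apply: isum_sub; first exact: isum_ideal).
    - by apply: isub_trans (isum_r _) => //; apply: isum_l.
    - exact: isum_l.
    - by apply: isub_trans (isum_r _).
  apply: isum_sub; first exact: isum_ideal.
    by apply: isub_trans (isum_l _) => //; apply: isum_r.
  apply: isum_sub; first exact: isum_ideal.
    by apply: isub_trans (isum_l _) => //; apply: isum_l.
  rewrite gen_cons ipow_isumS //; apply: isum_sub; first exact: isum_ideal.
    exact: isum_r.
  apply: isub_trans (isum_l _) => //; apply: isub_trans (isum_r _) => //.
  exact: imul_subl.
rewrite eN in hb.
have hyA0 := colon_ideal y hA0 hT.
have [||c hc hca] := has_len_subl (V := R^o) (submod_ideal (isum_ideal hA (hQ n)))
    (submod_ideal hyA0) (submod_ideal hT) _ _ ha.
- apply: isum_sub => // x hx; split=> //.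
    by apply: isum_l => //; apply: idMl.
  apply: isum_r => //; rewrite ipowS; apply: mem_imul => //.
  by apply: gen_mem; rewrite mem_head.
- by [].
move/(ilen_colon y c hA0 hT): hc => hc.
have hpA0 : is_ideal (isum (imul (prin y) unit_ideal) A0).
  by apply: isum_ideal => //; apply: imul_ideal.
exists (c + b)%N; first exact: ilen_add hc hb.
rewrite addSn /= addnS binS mulnDr; apply: leq_add; last first.
  by apply: leq_trans hbb _; rewrite addSn.
by apply: leq_trans hca _; apply: leq_trans hab _; rewrite /= addnS.
Qed.

End IdealLength.

(** * Hilbert's basis theorem and graded families of ideals *)

Section HilbertBasis.
Variable B : comNzRingType.
Implicit Types (S a b : B -> Prop) (p z : B).

(** Subrings and their ideals are predicates on one ambient ring, so the Rees algebra can live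
    inside [{poly R}] without a type of its own. *)
Definition subr S : Prop :=
  [/\ S 1, (forall x y, S x -> S y -> S (x - y)) &
      (forall x y, S x -> S y -> S (x * y))].
Definition sideal S a : Prop :=
  [/\ (forall x, a x -> S x), a 0, (forall x y, a x -> a y -> a (x + y)) &
      (forall s x, S s -> a x -> a (s * x))].
Definition sfg S a : Prop := exists g : seq B, (forall p, p \in g -> a p) /\
  forall b, sideal S b -> (forall p, p \in g -> b p) -> forall x, a x -> b x.
Definition snoeth S : Prop := forall a, sideal S a -> sfg S a.

Definition polyin S (q : {poly B}) : Prop := forall i, S q`_i.
Definition adj S z p : Prop := exists2 q, polyin S q & p = q.[z].

Section Subring.
Variable S : B -> Prop.
Hypothesis hS : subr S.

Lemma srg0 : S 0. Proof. by case: hS => h1 hB _; rewrite -(subrr 1); apply: (hB). Qed.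
Lemma srgD x y : S x -> S y -> S (x + y).
Proof.
case: hS => h1 hB _ hx hy; rewrite -[y]opprK; apply: (hB) => //.
by rewrite -sub0r; apply: (hB) => //; apply: srg0.
Qed.
Lemma srgN x : S x -> S (- x).
Proof. by case: hS => _ hB _ hx; rewrite -sub0r; apply: (hB) => //; apply: srg0. Qed.
Lemma srgM x y : S x -> S y -> S (x * y). Proof. by case: hS => _ _; apply. Qed.
Lemma srg_sum (T : Type) (r : seq T) (P : pred T) (F : T -> B) :
  (forall i, P i -> S (F i)) -> S (\sum_(i <- r | P i) F i).
Proof. by move=> h; apply: (big_ind S); [exact: srg0|exact: srgD|]. Qed.
Lemma polyin_subr q r : polyin S q -> polyin S r -> polyin S (q - r).
Proof. by move=> hq hr i; rewrite coefB; case: hS => _ hB _; apply: (hB). Qed.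

Lemma adj_subr z : subr (adj S z).
Proof.
split.
- exists 1; last by rewrite hornerC.
  by move=> i; rewrite coef1; case: (i == _); [case: hS | exact: srg0].
- move=> _ _ [q hq ->] [r hr ->]; exists (q - r); last by rewrite hornerD hornerN.
  exact: polyin_subr.
- move=> _ _ [q hq ->] [r hr ->]; exists (q * r); last by rewrite hornerM.
  by move=> i; rewrite coefM; apply: srg_sum => j _; apply: srgM.
Qed.

Lemma adj_base z x : S x -> adj S z x.
Proof.
move=> hx; exists x%:P; last by rewrite hornerC.
by move=> i; rewrite coefC; case: (i == _) => //; apply: srg0.
Qed.

Lemma adj_gen z : adj S z z.
Proof.
exists 'X; last by rewrite hornerX.
by move=> i; rewrite coefX; case: (i == _); [case: hS | exact: srg0].
Qed.

Lemma adj_sub (T : B -> Prop) z : subr T -> (forall x, S x -> T x) -> T z ->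
  forall x, adj S z x -> T x.
Proof.
move=> hT hST hz _ [q hq ->]; rewrite horner_coef.
apply: (big_ind T); first by case: hT => h1 hB _; rewrite -(subrr 1); apply: (hB).
  case: hT => h1 hB _ x y hx hy; rewrite -[y]opprK; apply: (hB) => //.
  by rewrite -sub0r; apply: (hB) => //; rewrite -(subrr 1); apply: (hB).
move=> i _; case: (hT) => h1 _ hM; apply: (hM); first exact: hST.
by elim: (i : nat) => [|k IH]; rewrite ?expr0 // exprS; apply: hM.
Qed.

Variable z : B.

(** The ideals of leading coefficients in Hilbert's proof. As [z] may satisfy relations over [S],
    the degree belongs to a representing polynomial and not to its value at [z]. *)
Definition leadc a n s : Prop :=
  S s /\ exists q, [/\ polyin S q, (size q <= n)%N & a (q.[z] + s * z ^+ n)].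

Lemma leadc_sideal a n : sideal (adj S z) a -> sideal S (leadc a n).
Proof.
move=> [aS a0 aD aM]; split; first by move=> x [].
- split; first exact: srg0.
  exists 0; rewrite size_poly0 horner0 mul0r addr0; split=> // i.
  by rewrite coef0; apply: srg0.
- move=> x y [hx [q [hq sq aq]]] [hy [r [hr sr ar]]]; split; first exact: srgD.
  exists (q + r); split.
  + by move=> i; rewrite coefD; apply: srgD.
  + by apply: leq_trans (size_polyD _ _) _; rewrite geq_max sq.
  + have -> : (q + r).[z] + (x + y) * z ^+ n =
        (q.[z] + x * z ^+ n) + (r.[z] + y * z ^+ n) by rewrite hornerD; ring.
    exact: aD.
- move=> s x hs [hx [q [hq sq aq]]]; split; first exact: srgM.
  exists (s%:P * q); split.
  + by move=> i; rewrite coefCM; apply: srgM.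
  + apply/leq_sizeP => j hj; rewrite coefCM nth_default ?mulr0 //.
    exact: leq_trans sq hj.
  + have -> : (s%:P * q).[z] + s * x * z ^+ n = s * (q.[z] + x * z ^+ n).
      by rewrite hornerM hornerC; ring.
    by apply: aM => //; apply: adj_base.
Qed.

Lemma leadcS a n s : sideal (adj S z) a -> leadc a n s -> leadc a n.+1 s.
Proof.
move=> [aS a0 aD aM] [hs [q [hq sq aq]]]; split=> //; exists (q * 'X); split.
- by move=> i; rewrite coefMX; case: (i == _) => //; apply: srg0.
- apply/leq_sizeP => j hj; rewrite coefMX.
  case: j hj => [|j] //= hj; rewrite nth_default //.
  exact: leq_trans sq hj.
- have -> : (q * 'X).[z] + s * z ^+ n.+1 = z * (q.[z] + s * z ^+ n).
    by rewrite hornerM hornerX exprS; ring.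
  by apply: aM => //; apply: adj_gen.
Qed.

Lemma leadc_le a n k s : sideal (adj S z) a -> (n <= k)%N -> leadc a n s -> leadc a k s.
Proof.
move=> ha hnk h; rewrite -(subnK hnk); elim: (k - n)%N => [|j IH] //.
by rewrite addSn; apply: leadcS.
Qed.

(** Hilbert's division: subtract from a member of [a] one of $a\cap b$ with the same leading
    coefficient, and induct on the degree. *)
Lemma leadc_cover a b : sideal (adj S z) a -> sideal (adj S z) b ->
  (forall n s, leadc a n s -> leadc (fun x => a x /\ b x) n s) ->
  forall x, a x -> b x.
Proof.
move=> ha hb h; have [aS a0 aD aM] := ha; have [bS b0 bD bM] := hb.
suff key n q : polyin S q -> (size q <= n)%N -> a q.[z] -> b q.[z].
  by move=> x ax; have [q hq e] := aS _ ax; rewrite e; apply: (key (size q)); rewrite -?e.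
elim: n q => [|n IH] q hq sq aq.
  by move: sq; rewrite leqn0 size_poly_eq0 => /eqP ->; rewrite horner0.
pose q0 := q - q`_n *: 'X^n.
have hq0 : polyin S q0.
  move=> i; rewrite /q0 coefB coefZ coefXn; case: (i == n); rewrite ?mulr1 ?mulr0.
    by case: hS => _ hB _; apply: (hB).
  by rewrite subr0.
have sq0 : (size q0 <= n)%N.
  apply/leq_sizeP => j; rewrite leq_eqVlt => /orP[/eqP <-|hj].
    by rewrite /q0 coefB coefZ coefXn eqxx mulr1 subrr.
  rewrite /q0 coefB coefZ coefXn gtn_eqF // mulr0 subr0 nth_default //.
  exact: leq_trans sq hj.
have eq0 : q.[z] = q0.[z] + q`_n * z ^+ n.
  by rewrite /q0 hornerD hornerN hornerZ hornerXn subrK.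
have [_ [r [hr sr [ar br]]]] : leadc (fun x => a x /\ b x) n q`_n.
  by apply: h; split=> //; exists q0; split=> //; rewrite -eq0.
have e : q.[z] = (q0 - r).[z] + (r.[z] + q`_n * z ^+ n).
  by rewrite eq0 hornerD hornerN; ring.
rewrite e; apply: bD => //; apply: IH.
- exact: polyin_subr.
- by apply: leq_trans (size_polyD _ _) _; rewrite size_polyN geq_max sq0.
have -> : (q0 - r).[z] = q.[z] + (-1) * (r.[z] + q`_n * z ^+ n) by rewrite e; ring.
apply: (aD) => //; apply: (aM) => //; apply: adj_base.
by apply: srgN; case: hS.
Qed.

Theorem hilbert_basis : snoeth S -> snoeth (adj S z).
Proof.
move=> hN a ha; have [aS a0 aD aM] := ha.
have hU : sideal S (fun s => exists n, leadc a n s).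
  have hL n := leadc_sideal n ha; split.
  - by move=> x [n []].
  - by exists 0%N; case: (hL 0%N).
  - move=> x y [n hn] [k hk]; exists (maxn n k).
    case: (hL (maxn n k)) => _ _ hD _; apply: hD.
      exact: (leadc_le ha (leq_maxl n k) hn).
    exact: (leadc_le ha (leq_maxr n k) hk).
  - by move=> s x hs [n hn]; exists n; case: (hL n) => _ _ _; apply.
(* Noetherianity of [S] gives a degree [n0] in which all leading coefficients already occur. Below,
   [G] lifts generators of the leading coefficient ideals in all degrees up to [n0]. *)
have [g [hg hgU]] := hN _ hU.
have [||n0 hn0] := @seq_bound _ (fun n s => leadc a n s) g.
- by move=> n k y hnk; apply: leadc_le.
- by move=> y /hg.
have hmax n s : leadc a n s -> leadc a n0 s.
  move=> h; apply: (hgU _ (leadc_sideal n0 ha) hn0); by exists n.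
pose P n (G : seq B) := exists g : seq B,
  (forall b, sideal S b -> (forall p, p \in g -> b p) -> forall x, leadc a n x -> b x) /\
  forall s, s \in g -> S s /\ exists2 q, polyin S q /\ (size q <= n)%N & q.[z] + s * z ^+ n \in G.
have step n : exists G, (forall p, p \in G -> a p) /\ P n G.
  have [gn [hgn hgnU]] := hN _ (leadc_sideal n ha).
  suff [G [hG1 hG2]] : exists G : seq B, (forall p, p \in G -> a p) /\ forall s, s \in gn ->
      S s /\ exists2 q, polyin S q /\ (size q <= n)%N & q.[z] + s * z ^+ n \in G.
    by exists G; split=> //; exists gn.
  elim: gn hgn {hgnU} => [|s gn IH] hgn; first by exists [::].
  have [|G [h1 h2]] := IH; first by move=> p hp; apply: hgn; rewrite inE hp orbT.
  have [hs [q [hq sq aq]]] := hgn s (mem_head _ _).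
  exists (q.[z] + s * z ^+ n :: G); split.
    by move=> p; rewrite inE => /orP[/eqP ->|/h1].
  move=> t; rewrite inE => /orP[/eqP ->|/h2 [ht [r hr hrG]]].
    by split=> //; exists q => //; rewrite mem_head.
  by split=> //; exists r => //; rewrite inE hrG orbT.
have [G [hG hGP]] : exists G : seq B, (forall p, p \in G -> a p) /\
    forall n, (n <= n0)%N -> P n G.
  elim: n0 {hn0 hmax} => [|k [G [h1 h2]]].
    have [G [h1 h2]] := step 0%N; exists G; split=> // n; rewrite leqn0 => /eqP ->.
    exact: h2.
  have [G' [h1' h2']] := step k.+1; exists (G ++ G'); split.
    by move=> p; rewrite mem_cat => /orP[/h1|/h1'].
  move=> n; rewrite leq_eqVlt => /orP[/eqP ->|].
    have [gg [h3 h4]] := h2'; exists gg; split=> // s /h4 [hs [q hq hqG]].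
    by split=> //; exists q => //; rewrite mem_cat hqG orbT.
  rewrite ltnS => /h2 [gg [h3 h4]]; exists gg; split=> // s /h4 [hs [q hq hqG]].
  by split=> //; exists q => //; rewrite mem_cat hqG.
exists G; split=> // b hb hGb.
have hab : sideal (adj S z) (fun x => a x /\ b x).
  case: hb => bS b0 bD bM; split=> //; first by move=> x [/aS].
    by move=> x y [? ?] [? ?]; split; [apply: aD|apply: bD].
  by move=> s x hs [? ?]; split; [apply: aM|apply: bM].
have low n s : (n <= n0)%N -> leadc a n s -> leadc (fun x => a x /\ b x) n s.
  move=> /hGP [gg [h1 h2]]; apply: h1; first exact: leadc_sideal.
  move=> t /h2 [ht [q [hq sq] hqG]]; split=> //; exists q; split=> //.
  by split; [apply: hG | apply: hGb].
apply: leadc_cover => // n s hs; case: (leqP n n0) => hn; first exact: low.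
by apply: (leadc_le hab (ltnW hn)); apply: low => //; apply: hmax hs.
Qed.

End Subring.

Fixpoint adjl S zs := if zs is z :: zs' then adjl (adj S z) zs' else S.

Lemma adjl_snoeth S zs : subr S -> snoeth S -> subr (adjl S zs) /\ snoeth (adjl S zs).
Proof.
elim: zs S => [|z zs IH] S hS hN //=; apply: IH; first exact: adj_subr.
exact: hilbert_basis.
Qed.

Lemma adjl_base S zs x : subr S -> S x -> adjl S zs x.
Proof.
by elim: zs S => [|z zs IH] S hS hx //=; apply: IH; [apply: adj_subr|apply: adj_base].
Qed.

Lemma adjl_gen S zs z : subr S -> z \in zs -> adjl S zs z.
Proof.
elim: zs S => [|y zs IH] S hS //=; rewrite inE => /orP[/eqP ->|].
  by apply: adjl_base; [apply: adj_subr | apply: adj_gen].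
by apply: IH; apply: adj_subr.
Qed.

Lemma adjl_sub S T zs : subr T -> subr S -> (forall x, S x -> T x) ->
  (forall z, z \in zs -> T z) -> forall x, adjl S zs x -> T x.
Proof.
move=> hT; elim: zs S => [|z zs IH] S hS hST hz //=; apply: IH.
- exact: adj_subr.
- by apply: adj_sub => //; apply: hz; rewrite mem_head.
- by move=> y hy; apply: hz; rewrite inE hy orbT.
Qed.

End HilbertBasis.

Section Rees.
Variable R : comNzRingType.
Hypothesis Rnoeth : is_noetherian R.
Implicit Types (x y w : R).
Variable I : ideal R.
Hypothesis hI : is_ideal I.

Definition rees (p : {poly R}) : Prop := forall n, ipow I n p`_n.
Definition pconst (p : {poly R}) : Prop := exists r, p = r%:P.

Lemma rees_subr : subr rees.
Proof.
have hP n := ipow_ideal n hI; split.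
- by case=> [|n]; rewrite ?ipow0 // coef1; apply: id0.
- by move=> p q hp hq n; rewrite coefB; apply: idB.
- move=> p q hp hq n; rewrite coefM; apply: id_sum => // i _.
  by rewrite -{1}(subnKC (leq_ord i)); apply: mem_ipowD.
Qed.

Lemma pconst_subr : subr pconst.
Proof.
split; first by exists 1.
  by move=> _ _ [a ->] [b ->]; exists (a - b); rewrite polyCB.
by move=> _ _ [a ->] [b ->]; exists (a * b); rewrite polyCM.
Qed.

Lemma pconst_snoeth : snoeth pconst.
Proof.
move=> a [aS a0 aD aM].
have hid : is_ideal (fun r => a r%:P).
  split=> // [x y hx hy|r x hx]; first by rewrite polyCD; apply: aD.
  by rewrite polyCM; apply: aM => //; exists r.
have [s hs] := Rnoeth hid; exists [seq r%:P | r <- s]; split.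
  by move=> _ /mapP [r hr ->]; apply/hs/gen_mem.
move=> b [bS b0 bD bM] h x ax; have [r e] := aS _ ax; rewrite e in ax *.
have hid' : is_ideal (fun r => b r%:P).
  split=> // [u y hx hy|u y hx]; first by rewrite polyCD; apply: bD.
  by rewrite polyCM; apply: bM => //; exists u.
move/hs: ax; apply: (gen_sub hid') => y hy; apply: h; exact: map_f.
Qed.

(** The Rees algebra is $R[y_1X,\dots,y_kX]$ for generators $y_i$ of [I], so finitely many uses of
    [hilbert_basis] reach it from the constants. *)
Lemma rees_snoeth : snoeth rees.
Proof.
have [ys hys] := Rnoeth hI; move: (ideal_ext hys) => eI.
have [hT hTN] := adjl_snoeth [seq y%:P * 'X | y <- ys] pconst_subr pconst_snoeth.
set T := adjl _ _ in hT hTN; suff <- : T = rees by [].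
have TC r : T r%:P by apply: adjl_base; [exact: pconst_subr | exists r].
have idT n : is_ideal (fun r => T (r%:P * 'X^n)).
  split; first by rewrite mul0r; apply: srg0.
    by move=> x y hx hy; rewrite polyCD mulrDl; apply: srgD.
  by move=> r x hx; rewrite polyCM -mulrA; apply: srgM.
have TI n x : ipow I n x -> T (x%:P * 'X^n).
  elim: n x => [|n IH] x; first by rewrite expr0 mulr1.
  rewrite ipowS; apply: (imul_sub (idT n.+1)) => y w hy hw.
  have -> : (y * w)%:P * 'X^(n.+1) = (y%:P * 'X) * (w%:P * 'X^n).
    by rewrite polyCM exprS; ring.
  apply: srgM => //; last exact: IH.
  move: y hy; rewrite -['X]expr1 eI; apply: (gen_sub (idT 1%N)) => y hy.
  rewrite expr1; apply: adjl_gen; first exact: pconst_subr.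
  by apply: (map_f (fun y : R => y%:P * (@polyX R))); exact: hy.
apply: functional_extensionality => p; apply: propositional_extensionality; split.
  apply: adjl_sub; [exact: rees_subr|exact: pconst_subr| |].
    move=> _ [r ->] [|n]; rewrite coefC; first by [].
    exact: (id0 (ipow_ideal n.+1 hI)).
  move=> _ /mapP [y hy ->] n; rewrite coefCM coefX; case: eqP => [->|_].
    by rewrite mulr1 ipow1 // eI; apply: gen_mem.
  by rewrite mulr0; apply: id0; apply: ipow_ideal.
move=> hp; rewrite -[p]coefK poly_def; apply: srg_sum => // i _.
by rewrite -mul_polyC; apply: TI.
Qed.

Lemma graded_mulX (W : nat -> ideal R) :
  (forall n, is_ideal (W n)) -> (forall n x w, I x -> W n w -> W n.+1 (x * w)) ->
  forall i n s w, ipow I i s -> W n w -> W (i + n)%N (s * w).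
Proof.
move=> hW hgr; elim=> [|i IH] n s w; first by move=> _; apply: idMl.
move=> + hw; rewrite ipowS.
apply: (imul_sub (K := fun s => W (i.+1 + n)%N (s * w))).
  split; first by rewrite mul0r; apply: id0.
    by move=> x y hx hy; rewrite mulrDl; apply: idD.
  by move=> a x hx; rewrite -mulrA; apply: idMl.
by move=> x y hx hy; rewrite -mulrA; apply: hgr => //; apply: IH.
Qed.

(** Each [W k] describes a homogeneous ideal of the Rees algebra. Finitely many generators of the
    union lie in a single one, so the bound is uniform in the degree [n]. *)
Theorem graded_acc (W : nat -> nat -> ideal R) :
  (forall k n, is_ideal (W k n)) -> (forall k n, isub (W k n) (ipow I n)) ->
  (forall k n x w, I x -> W k n w -> W k n.+1 (x * w)) ->
  (forall k n, isub (W k n) (W k.+1 n)) ->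
  exists k0, forall k n, isub (W k n) (W k0 n).
Proof.
move=> hW hWI hgr hinc.
have mono n k k' : (k <= k')%N -> isub (W k n) (W k' n).
  by apply: (@chain_le _ (fun k => W k n)).
have hU n : is_ideal (fun x => exists k, W k n x).
  by apply: (@chain_union_ideal _ (fun k => W k n)).
have hmul (V : nat -> ideal R) : (forall n, is_ideal (V n)) ->
    (forall n x w, I x -> V n w -> V n.+1 (x * w)) ->
    (forall n, isub (V n) (ipow I n)) -> sideal rees (fun p => forall n, V n p`_n).
  move=> hV hg hVI; split.
  - by move=> p hp n; apply/hVI.
  - by move=> n; rewrite coef0; apply: id0.
  - by move=> p q hp hq n; rewrite coefD; apply: idD.
  - move=> s p hs hp n; rewrite coefM; apply: id_sum => // i _.
    rewrite -[X in V X _](subnKC (leq_ord i)); exact: graded_mulX.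
have [||g [hg hgen]] := rees_snoeth (hmul (fun n x => exists k, W k n x) hU _ _).
- by move=> n x w hx [k hk]; exists k; apply: hgr.
- by move=> n x [k /hWI].
have [||k0 hk0] := @seq_bound _ (fun k (p : {poly R}) => forall n, W k n p`_n) g.
- by move=> n k p hnk hp i; apply: mono (hp i).
- move=> p /hg hp.
  have [||k hk] := @nat_bound (fun k n => W k n p`_n) (size p).
  + by move=> k k' n hk; apply: mono.
  + by move=> n _; apply: hp.
  exists k => n; case: (ltnP n (size p)) => hn; first exact: hk.
  by rewrite nth_default //; apply: id0.
exists k0 => k n w hw.
have hwX i : exists k, W k i (w%:P * 'X^n)`_i.
  rewrite coefCM coefXn; case: eqP => [->|_]; first by rewrite mulr1; exists k.
  by rewrite mulr0; exists k; apply: id0.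
have := hgen _ (hmul (W k0) (hW k0) (hgr k0) (hWI k0)) hk0 _ hwX n.
by rewrite coefCM coefXn eqxx mulr1.
Qed.

Lemma graded_stable (W : nat -> ideal R) :
  (forall n, is_ideal (W n)) -> (forall n, isub (W n) (ipow I n)) ->
  (forall n x w, I x -> W n w -> W n.+1 (x * w)) ->
  exists M, forall n, (M <= n)%N -> isub (W n) (imul (ipow I (n - M)) (W M)).
Proof.
move=> hW hWI hgr; have hmul := graded_mulX hW hgr.
have hP n := ipow_ideal n hI.
(* The part of [W] generated in degrees up to [k]; it grows with [k], and [graded_acc] gives the [k]
   where it is everything. *)
pose V k n := if (n <= k)%N then W n else imul (ipow I (n - k)) (W k).
have hV k n : is_ideal (V k n) by rewrite /V; case: ifP => // _; apply: imul_ideal.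
have VW k n : isub (V k n) (W n).
  rewrite /V; case: leqP => // hn; apply: imul_sub => // s w hs hw.
  by rewrite -(subnK (ltnW hn)); apply: hmul.
have [|||M hM] := @graded_acc V hV.
- by move=> k n x /VW/hWI.
- move=> k n x w hx; rewrite /V; case: (leqP n k) => h1.
    move=> hw; case: leqP => h2; last exact: hgr.
    have e : n = k by lia.
    by rewrite -e subSnn ipow1 //; apply: mem_imul.
  rewrite leqNgt (leq_trans h1 (leqnSn n)) /= subSn; last exact: ltnW.
  rewrite ipowS -imulA // => hw; exact: mem_imul.
- move=> k n; rewrite /V; case: (leqP n k) => h1; first by rewrite (leqW h1).
  case: leqP => h2.
    have e : n = k.+1 by apply/eqP; rewrite eqn_leq h1 h2.
    rewrite e subSnn ipow1 //; apply: imul_sub => //; exact: hgr.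
  have e : (n - k = (n - k.+1) + 1)%N by lia.
  rewrite e ipowD // -imulA //; apply: imul_mono => //.
  by rewrite ipow1 //; apply: imul_sub => //; apply: hgr.
exists M => n hn x hx; case: (leqP n M) => h.
  by have e : n = M by [lia]; rewrite -e subnn imul1l.
by have := hM n n x; rewrite /V leqnn leqNgt h => /(_ hx).
Qed.

End Rees.

(** * Generic elements *)

Section Generic.
Variable R : comNzRingType.
Hypothesis Rnoeth : is_noetherian R.
Implicit Types (x y w : R).

Definition graded (I : ideal R) (W : nat -> ideal R) : Prop :=
  [/\ (forall n, is_ideal (W n)), (forall n, isub (W n) (ipow I n)) &
      (forall n x w, I x -> W n w -> W n.+1 (x * w))].

Section Avoidance.
Variables (I : ideal R) (B : nat -> ideal R).
Hypotheses (hI : is_ideal I) (hB : graded I B).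

Definition ann (z : nat -> R) (C : nat -> ideal R) (ks : seq nat) (n : nat) : ideal R :=
  fun w => C n w /\ forall k, k \in ks -> B n.+1 (z k * w).

(** Nonvanishing modulo [B] in infinitely many degrees; only large degrees matter for superficial
    elements. *)
Definition big (W : nat -> ideal R) : Prop :=
  forall n0, exists2 n, (n0 <= n)%N & ~ isub (W n) (B n).

Lemma ann_graded z C ks : graded I C -> graded I (ann z C ks).
Proof.
case: hB => bid bI bM [cid cI cM]; split.
- move=> n; split; first by split=> [|k _]; rewrite ?mulr0; apply: id0.
    move=> x y [hx hx'] [hy hy']; split; first exact: idD.
    by move=> k hk; rewrite mulrDr; apply: idD => //; [apply: hx' | apply: hy'].
  move=> a x [hx hx']; split; first exact: idMl.
  by move=> k hk; rewrite mulrCA; apply: idMl => //; apply: hx'.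
- by move=> n w [hw _]; apply: cI.
- move=> n x w hx [hw hw']; split; first exact: cM.
  by move=> k hk; rewrite mulrCA; apply: bM => //; apply: hw'.
Qed.

Fixpoint annsum z C k n : ideal R :=
  if k is k'.+1 then isum (annsum z C k' n) (ann z C [:: k'] n) else izero.

Lemma annsum_graded z C k : graded I C -> graded I (annsum z C k).
Proof.
move=> hC; elim: k => [|k [h1 h2 h3]] /=.
  split=> [n|n _ ->|n x w _ ->]; first exact: izero_ideal.
    by apply: id0; apply: ipow_ideal.
  by rewrite mulr0.
have [h4 h5 h6] := ann_graded z [:: k] hC; split.
- by move=> n; apply: isum_ideal.
- by move=> n; apply: isum_sub => //; apply: ipow_ideal.
- move=> n x w hx [a [b [ha hb ->]]]; exists (x * a), (x * b).
  by split; [apply: h3 | apply: h6 | rewrite mulrDr].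
Qed.

Fixpoint zprod (z : nat -> R) k : R := if k is k'.+1 then z k' * zprod z k' else 1.

Lemma zprod_ipow z k : (forall k, I (z k)) -> ipow I k (zprod z k).
Proof. by move=> hz; elim: k => [|k IH] //; rewrite ipowS; apply: mem_imul. Qed.

Lemma zprod_annsum z C k n w : (forall k, I (z k)) -> graded I C ->
  annsum z C k n w -> B (k + n)%N (zprod z k * w).
Proof.
move=> hz hC; have [bid bI bM] := hB; elim: k w => [|k IH] w /=.
  by move=> ->; rewrite mulr0; apply: id0.
move=> [a [b [ha [hb hb'] ->]]]; rewrite mulrDr; apply: idD => //.
  by rewrite -mulrA; apply: bM => //; apply: IH.
rewrite [z k * _]mulrC -mulrA addSnnS; apply: graded_mulX bid bM _ _ _ _ _ _.
  exact: zprod_ipow.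
by apply: hb'; rewrite mem_head.
Qed.

(* If infinitely many of the kernels N_l of z_l are nonzero in large degrees,
   then by Noetherianity all of them lie in the sum of finitely many N_i;
   a product of z_i's kills that sum, so some N_i meets infinitely many N_l. *)
Lemma ann_meet j z C : (forall k, I (z k)) -> graded I C ->
  (forall n, exists2 k, (n <= k)%N & big (ann z C [:: k])) ->
  exists ks, [/\ uniq ks, size ks = j & big (ann z C ks)].
Proof.
elim: j z C => [|j IH] z C hz hC hbig.
  have [k _ hk] := hbig 0%N; exists [::]; split=> // n0.
  have [n hn hnB] := hk n0; exists n => // h; apply: hnB => w [hw _].
  by apply: h; split.
have [bid bI bM] := hB; have [cid cI cM] := hC.
have hS k := annsum_graded z k hC.
have [||||k0 hk0] := @graded_acc R Rnoeth I hI (annsum z C).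
- by move=> k; case: (hS k).
- by move=> k; case: (hS k).
- by move=> k; case: (hS k).
- move=> k n /=; apply: isum_l; by case: (ann_graded z [:: k] hC).
have hmeet l : big (ann z C [:: l]) ->
    exists2 i, (i < k0)%N & big (ann z C [:: i; l]).
  move=> hl; apply: NNPP => hno.
  have [||n1 hn1] := @nat_bound (fun n1 i =>
      forall n, (n1 <= n)%N -> isub (ann z C [:: i; l] n) (B n)) k0.
  - by move=> n n' i hn h k hk; apply: h; apply: leq_trans hk.
  - move=> i hi; apply: NNPP => h; apply: hno; exists i => // n0.
    apply: NNPP => h'; apply: h; exists n0 => n hn; apply: NNPP => h''.
    by apply: h'; exists n.
  have [n hn hnB] := hl n1; apply: hnB => w hw; apply: NNPP => hwB.
  (* If each kernel of index below [k0] met that of [l] only inside [B], the factors of [zprod z k0]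
     could be cancelled one by one, although this product kills a sum containing the kernel of
     [l]. *)
  have key i : (i <= k0)%N -> ~ B (i + n)%N (zprod z i * w).
    elim: i => [|i IHi] hi; first by rewrite mul1r.
    move=> h; apply: (IHi (ltnW hi)); apply: (hn1 i hi).
      by apply: leq_trans hn _; apply: leq_addl.
    have [hCw hlw] := hw; split.
      by apply: graded_mulX cid cM _ _ _ _ _ _ => //; apply: zprod_ipow.
    move=> k; rewrite !inE => /orP[/eqP->|/eqP->].
      by rewrite mulrA.
    rewrite mulrCA -addnS; apply: graded_mulX bid bM _ _ _ _ _ _.
      exact: zprod_ipow.
    by apply: hlw; rewrite mem_head.
  apply: (key k0 (leqnn _)); apply: (zprod_annsum hz hC).
  apply: (hk0 l.+1); exists 0, w; rewrite add0r; split=> //.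
  by apply: id0; case: (hS l).
have [i hi hinf] : exists2 i, (i < k0)%N &
    forall n, exists2 l, (n <= l)%N & big (ann z C [:: i; l]).
  apply: NNPP => hno.
  have [||n1 hn1] := @nat_bound (fun n1 i =>
      forall l, (n1 <= l)%N -> ~ big (ann z C [:: i; l])) k0.
  - by move=> n n' i hn h l hl; apply: h; apply: leq_trans hl.
  - move=> i hi; apply: NNPP => h; apply: hno; exists i => // n.
    apply: NNPP => h'; apply: h; exists n => l hl hb; apply: h'.
    by exists l.
  have [l hl /hmeet [i hi hb]] := hbig n1.
  exact: hn1 hi l hl hb.
(* Indices from [k0] on differ from [i], as [uniq] requires. *)
pose z' k := z (k0 + k)%N.
have [|||ks [hu hs hb]] := IH z' (ann z C [:: i]).
- by move=> k; apply: hz.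
- exact: ann_graded.
- move=> n; have [l hl hb] := hinf (k0 + n)%N; exists (l - k0)%N; first by lia.
  move=> n0; have [n' hn' h] := hb n0; exists n' => // h'; apply: h => w [hw hw'].
  apply: h'; split; first split=> // k.
    by rewrite inE => /eqP ->; apply: hw'; rewrite mem_head.
  move=> k; rewrite inE => /eqP ->; rewrite /z' subnKC; last by lia.
  by apply: hw'; rewrite !inE eqxx orbT.
exists (i :: [seq (k0 + k)%N | k <- ks]); split=> /=.
- rewrite map_inj_uniq ?hu ?andbT; last exact: addnI.
  by apply/mapP => -[k _ e]; move: hi; rewrite e ltnNge leq_addr.
- by rewrite size_map hs.
- move=> n0; have [n hn h] := hb n0; exists n => // h'; apply: h => w [[hw hi'] hw'].
  apply: h'; split=> // k; rewrite inE => /orP[/eqP ->|/mapP [k' hk' ->]].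
    by apply: hi'; rewrite mem_head.
  exact: hw'.
Qed.

Lemma ann_finite s z C : (forall k, I (z k)) -> graded I C ->
  (forall ks, uniq ks -> size ks = s -> ~ big (ann z C ks)) ->
  exists k0, forall k, (k0 <= k)%N -> exists n0, forall n, (n0 <= n)%N ->
    forall w, C n w -> B n.+1 (z k * w) -> B n w.
Proof.
move=> hz hC h; apply: NNPP => hno.
have [|ks [hu hs]] := @ann_meet s z C hz hC; last exact: h.
move=> n; apply: NNPP => hn; apply: hno; exists n => k hk.
apply: NNPP => h'; apply: hn; exists k => // n0; apply: NNPP => h2; apply: h'.
exists n0 => n' hn' w hw hzw; apply: NNPP => hwB; apply: h2; exists n' => // h3.
by apply/hwB/h3; split=> // k'; rewrite inE => /eqP ->.
Qed.

End Avoidance.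

(** * General elements over an infinite residue field *)

Variable m : ideal R.
Hypothesis mloc : is_local m.
Variable f : nat -> R.
Hypothesis hf : forall i j, m (f i - f j) -> i = j.

(** Points of the moment curve serve as general elements: differences of the [f k] are units, so by
    Vandermonde any [size g] of these elements with distinct indices generate the same ideal as
    [g]. *)
Definition vand (g : seq R) (k : nat) : R := \sum_(i < size g) f k ^+ i * g`_i.

Lemma vand_mem J g k : is_ideal J -> (forall y, y \in g -> J y) -> J (vand g k).
Proof.
by move=> hJ hg; apply: id_sum => // i _; apply: idMl => //; apply/hg/mem_nth.
Qed.

Lemma vand_gen g ks D w : is_ideal D -> uniq ks -> size ks = size g ->
  (forall k, k \in ks -> D (vand g k * w)) -> forall y, y \in g -> D (y * w).
Proof.
move=> hD hu hs h y /(nthP 0) [i0 hi0 <-]; set s := size g in hs hi0.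
pose a : 'rV[R]_s := \row_j f (nth 0%N ks j).
pose V := Vandermonde s a; pose u : 'rV[R]_s := \row_i (g`_i * w).
have hdet : ~ m (\det V).
  rewrite det_Vandermonde.
  apply: (big_ind (fun x => ~ m x)); [exact: local_proper mloc|exact: local_mulN|].
  move=> i _.
  apply: (big_ind (fun x => ~ m x)); [exact: local_proper mloc|exact: local_mulN|].
  move=> j hij; rewrite !mxE => /hf /eqP; rewrite nth_uniq ?hs // => /eqP e.
  by move: hij; rewrite e ltnn.
have hV j : D ((u *m V) 0 j).
  have -> : (u *m V) 0 j = vand g (nth 0%N ks j) * w.
    rewrite mxE /vand mulr_suml; apply: eq_bigr => i _; rewrite !mxE; ring.
  by apply/h/mem_nth; rewrite hs.
have e : \det V * (g`_i0 * w) = (u *m V *m \adj V) 0 (Ordinal hi0).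
  by rewrite -mulmxA mul_mx_adj mul_mx_scalar !mxE.
apply: (local_cancel Rnoeth mloc hD hdet); rewrite e mxE.
by apply: id_sum => // j _; apply: idMr.
Qed.

Lemma ipow_unit n : ipow unit_ideal n = @unit_ideal R.
Proof. by elim: n => [|n IH] //; rewrite ipowS IH imul1l. Qed.

(** The case of the unit ideal with filtration constantly [A]: what [size g] of the elements
    [vand g k] send into [A] is sent there by [d] too, hence lies in [A]. *)
Lemma generic_nzd A g d : is_ideal A -> gen_ideal g d -> nzd A d ->
  exists k0, forall k, (k0 <= k)%N -> nzd A (vand g k).
Proof.
move=> hA hd hnd; have hT := @unit_ideal_ideal R.
have hB : graded unit_ideal (fun=> A).
  split=> // [n x _|n x w _]; [by rewrite ipow_unit | exact: idMl].
have hC : graded unit_ideal (fun=> unit_ideal).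
  by split=> // n x _; rewrite ipow_unit.
have [||k0 hk0] := @ann_finite unit_ideal (fun=> A) hT hB (size g) (vand g) _ _ hC.
- by [].
- move=> ks hu hs hb; have [n _] := hb 0%N; apply=> w [_ hw]; apply: hnd.
  have hid : is_ideal (fun y => A (y * w)).
    split; first by rewrite mul0r; apply: id0.
      by move=> x y hx hy; rewrite mulrDl; apply: idD.
    by move=> a x hx; rewrite -mulrA; apply: idMl.
  apply: (gen_sub hid _ hd) => y; exact: (vand_gen hA hu hs hw).
exists k0 => k /hk0 [n0 hn0] w; exact: (hn0 n0 (leqnn _) w).
Qed.

(** Enough elements [vand g k] have the same common kernel $C$ as all of [g]. In large degrees
    $C_n=I^{n-M}C_M$, and the reduction equation extracts from $I^{n-M}$ a factor in [gen_ideal g],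
    which sends $C_M$ into [B]. *)
Lemma generic_superficial I B g r : is_ideal I -> graded I B ->
  isub (gen_ideal g) I -> ipow I r.+1 = imul (gen_ideal g) (ipow I r) ->
  exists k0, forall k, (k0 <= k)%N -> exists n0, forall n, (n0 <= n)%N ->
    forall w, ipow I n w -> B n.+1 (vand g k * w) -> B n w.
Proof.
move=> hI hB hgI hr; have [bid bI bM] := hB.
have hP n := ipow_ideal n hI; have hg := gen_ideal_ideal g.
have hF : graded I (ipow I).
  by split=> // n x w hx hw; rewrite ipowS; apply: mem_imul.
apply: (@ann_finite I B hI hB (size g)) => //.
  by move=> k; apply: vand_mem => // y hy; apply/hgI/gen_mem.
move=> ks hu hs hb.
pose C n w := ipow I n w /\ forall y, y \in g -> B n.+1 (y * w).
have hCid n : is_ideal (C n).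
  split; first by split=> [|y _]; rewrite ?mulr0; apply: id0.
    move=> x y [hx hx'] [hy hy']; split; first exact: idD.
    by move=> k hk; rewrite mulrDr; apply: idD => //; [apply: hx' | apply: hy'].
  move=> a x [hx hx']; split; first exact: idMl.
  by move=> k hk; rewrite mulrCA; apply: idMl => //; apply: hx'.
have [||M hM] := @graded_stable R Rnoeth I hI C hCid.
- by move=> n w [].
- move=> n x w hx [hw hw']; split; first by rewrite ipowS; apply: mem_imul.
  by move=> y hy; rewrite mulrCA; apply: bM => //; apply: hw'.
have [n hn] := hb (M + r.+1)%N; apply=> w [hw hw'].
have /hM : C n w by split=> //; apply: vand_gen hw'.
move=> /(_ (leq_trans (leq_addr _ _) hn)).
have e : (n - M = r.+1 + (n - M - r.+1))%N by lia.
set t := (n - M - r.+1)%N in e; rewrite e ipowD // hr.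
apply: (imul_sub (bid n)) => v w' hv [_ hw'']; move: v hv; rewrite -imulA // => v.
have hid : is_ideal (fun v => B n (v * w')).
  split; first by rewrite mul0r; apply: id0.
    by move=> x y hx hy; rewrite mulrDl; apply: idD.
  by move=> a x hx; rewrite -mulrA; apply: idMl.
apply: (imul_sub hid) => y x hy; rewrite -ipowD // => hx.
have hid' : is_ideal (fun y => B M.+1 (y * w')).
  split; first by rewrite mul0r; apply: id0.
    by move=> x' y' hx' hy'; rewrite mulrDl; apply: idD.
  by move=> a x' hx'; rewrite -mulrA; apply: idMl.
have -> : n = (r + t + M.+1)%N by lia.
rewrite [y * x]mulrC -mulrA; apply: graded_mulX bid bM _ _ _ _ hx _.
exact: (gen_sub hid' hw'' hy).
Qed.

End Generic.

(** * Minimal reductions generated by a regular sequence *)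

Section Reduction.
Variable R : comNzRingType.
Hypothesis Rnoeth : is_noetherian R.
Variable m : ideal R.
Hypothesis mloc : is_local m.
Variable f : nat -> R.
Hypothesis hf : forall i j, m (f i - f j) -> i = j.
Implicit Types (x y w : R) (ys zs : seq R).

Definition bdiff (p : nat -> int) (n : nat) : int := p n - p n.-1.

Variables (I : ideal R) (g : seq R) (r : nat).
Hypothesis hI : is_ideal I.
Hypothesis hIm : forall x, m x <-> exists n, I (x ^+ n).
Hypothesis hgI : isub (gen_ideal g) I.
Hypothesis hr : ipow I r.+1 = imul (gen_ideal g) (ipow I r).

(** $I^n$ modulo this is the degree [n] part of the associated graded ring of [I] divided by the
    degree one classes of [ys]. At [n = 0] the truncated predecessor gives $I+(ys)$, which is $I$
    when [ys] lie in [I]. *)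
Definition quot_filt ys n : ideal R :=
  isum (ipow I n.+1) (imul (gen_ideal ys) (ipow I n.-1)).

Lemma quot_filt_ideal ys n : is_ideal (quot_filt ys n).
Proof.
by apply: isum_ideal; [apply: ipow_ideal | apply/imul_ideal/gen_ideal_ideal].
Qed.

Lemma quot_filt_sub ys n : isub (gen_ideal ys) I -> isub (quot_filt ys n) (ipow I n).
Proof.
move=> hys; have hP k := ipow_ideal k hI; apply: isum_sub => //.
  by apply: ipow_le.
case: n => [|n] //; exact: imul_mono.
Qed.

Lemma quot_filt_graded ys : isub (gen_ideal ys) I -> graded I (quot_filt ys).
Proof.
move=> hys; have hP k := ipow_ideal k hI; have hg := gen_ideal_ideal ys; split.
- exact: quot_filt_ideal.
- by move=> n; apply: quot_filt_sub.
- move=> n x w hx [a [b [ha hb ->]]]; exists (x * a), (x * b); split.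
  + by rewrite ipowS; apply: mem_imul.
  + case: n hb {ha} => [|n] hb; first by apply: idMl => //; apply: imul_ideal.
    change (imul (gen_ideal ys) (ipow I n.+1) (x * b)).
    by rewrite ipowS imulCA //; apply: mem_imul.
  + by rewrite mulrDr.
Qed.

Lemma quot_filt_rcons ys y n :
  isum (imul (prin y) (ipow I n)) (quot_filt ys n.+1) = quot_filt (rcons ys y) n.+1.
Proof.
have hg := gen_ideal_ideal ys; have hp := prin_ideal y; have hP k := ipow_ideal k hI.
rewrite /quot_filt /= -cats1 gen_cat gen1 imul_suml // isumC -isumA.
by congr isum; rewrite isumC.
Qed.

Lemma isub_Im : isub I m.
Proof. by move=> x hx; apply/hIm; exists 1%N; rewrite expr1. Qed.

Variable p0 : nat -> int.
Hypothesis hp0 : exists n0, forall n, (n0 <= n)%N ->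
  exists2 l, ilen (ipow I n.+1) (ipow I n) l & l%:Z = p0 n.

(** A general [y] of [gen_ideal g] takes the place of [z]: it is regular modulo [ys] and the
    remaining reservoir [zs], and its class is injective in large degrees of the quotient graded
    ring, so the Hilbert function passes to its difference. *)
Lemma superficial_step j ys zs z :
  (forall y, y \in ys -> gen_ideal g y) -> (forall x, x \in rcons zs z -> m x) ->
  reg izero (ys ++ rcons zs z) ->
  (exists n0, forall n, (n0 <= n)%N ->
    exists2 l, ilen (quot_filt ys n) (ipow I n) l & l%:Z = iter j bdiff p0 n) ->
  exists y, [/\ gen_ideal g y, reg izero (rcons ys y ++ zs) &
    exists n0, forall n, (n0 <= n)%N ->
    exists2 l, ilen (quot_filt (rcons ys y) n) (ipow I n) l &
      l%:Z = iter j.+1 bdiff p0 n].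
Proof.
move=> hys hzs hreg [n0 hn0].
have h0 := @izero_ideal R; have hgi := gen_ideal_ideal g.
have hysI : isub (gen_ideal ys) I.
  by apply: gen_sub => // y hy; apply/hgI/hys.
have hA := gen_ideal_ideal (ys ++ zs).
have hzm z' : z' \in zs -> m z'.
  by move=> hz; apply: hzs; rewrite mem_rcons inE hz orbT.
have hreg' : reg izero ((ys ++ zs) ++ [:: z]) by rewrite -catA cats1.
move: hreg'; rewrite reg_cat // isumC isum0 //= => -[hreg1 [hz _]].
have [a ha] : exists a, I (z ^+ a).
  by apply/hIm; apply: hzs; rewrite mem_rcons mem_head.
(* As $I^{r+1}$ lies in [gen_ideal g], a power of [z] does. It is regular modulo [ys ++ zs], so
   [generic_nzd] applies. *)
have hd : gen_ideal g (z ^+ (a * r.+1)).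
  have := mem_expr r.+1 hI ha; rewrite -exprM hr; apply: imul_subl => //.
have [k1 hk1] := generic_nzd Rnoeth mloc hf hA hd (nzd_exp hz).
have hB := quot_filt_graded hysI.
have [k2 hk2] := generic_superficial Rnoeth mloc hf hI hB hgI hr.
set k := maxn k1 k2; have hy1 := hk1 k (leq_maxl _ _).
have [n1 hn1] := hk2 k (leq_maxr _ _).
set y := vand f g k in hy1 hn1.
have hyg : gen_ideal g y by apply: vand_mem => // y' /gen_mem.
exists y; split=> //.
  have : reg izero ((ys ++ zs) ++ [:: y]).
    by rewrite reg_cat //; split=> //; rewrite isumC isum0.
  rewrite -catA cats1 reg_cat // => -[h1 h2].
  rewrite cat_rcons reg_cat //; split=> //.
  apply: (reg_rcons_cons Rnoeth mloc) => //.
  by apply: isum_ideal => //; apply: gen_ideal_ideal.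
exists (maxn n0 n1).+1 => -[|n] // hn.
have [hn2 hn3] : (n0 <= n)%N /\ (n1 <= n)%N by lia.
have [l hl el] := hn0 n hn2; have [l' hl' el'] := hn0 n.+1 (leqW hn2).
have hP i := ipow_ideal i hI; have hQ := quot_filt_ideal ys.
have eC : quot_filt ys n = (fun w => ipow I n w /\ quot_filt ys n.+1 (y * w)).
  apply: isub_antisym => w.
    move=> hw; split; first exact: quot_filt_sub hw.
    by case: hB => _ _; apply=> //; apply: hgI.
  by move=> [h1 h2]; apply: hn1.
rewrite eC in hl; move/(ilen_colon y l (hQ n.+1) (hP n)): hl.
rewrite quot_filt_rcons => hl.
have hQr := quot_filt_ideal (rcons ys y) n.+1.
have [||c [d [hc hd' e]]] := ilen_split (hQ n.+1) hQr (hP n.+1) _ _ hl'.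
- rewrite -quot_filt_rcons; apply: isum_r; apply: imul_ideal.
  exact: prin_ideal.
- apply: quot_filt_sub; apply: gen_sub => // y'.
  by rewrite mem_rcons inE => /orP[/eqP ->|/hys]; apply: hgI.
exists d => //=; rewrite /bdiff /= -el -el' e (ilen_uniq hl hc) PoszD; ring.
Qed.

Lemma reduction_exists d zs : size zs = d -> (forall z, z \in zs -> m z) ->
  reg izero zs ->
  exists ys, [/\ size ys = d, (forall y, y \in ys -> gen_ideal g y), reg izero ys &
    exists n0, forall n, (n0 <= n)%N ->
    exists2 l, ilen (quot_filt ys n) (ipow I n) l & l%:Z = iter d bdiff p0 n].
Proof.
move=> hs hz hreg.
suff key j : (j <= d)%N -> exists ys zs, [/\ size ys = j, size zs = (d - j)%N,
    (forall y, y \in ys -> gen_ideal g y) /\ (forall z, z \in zs -> m z),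
    reg izero (ys ++ zs) &
    exists n0, forall n, (n0 <= n)%N ->
    exists2 l, ilen (quot_filt ys n) (ipow I n) l & l%:Z = iter j bdiff p0 n].
  have [ys [zs' [h1 h2 [h3 _] h4 h5]]] := key d (leqnn d); exists ys; split=> //.
  by move: h2 h4; rewrite subnn => /size0nil ->; rewrite cats0.
elim: j => [|j IH] hj.
  exists [::], zs; split=> //; first by rewrite subn0.
  have [n0 hn0] := hp0; exists n0 => n /hn0 [l hl el]; exists l => //.
  rewrite /quot_filt gen_nil (_ : imul izero _ = izero); last first.
    apply: isub_antisym; first exact: imul_subl (@izero_ideal R).
    by move=> x ->; apply: id0; apply/imul_ideal/izero_ideal.
  by rewrite isum0 //; apply: ipow_ideal.
have [ys [zs' [h1 h2 [h3 h3'] h4 h5]]] := IH (ltnW hj).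
case/lastP: zs' h2 h3' h4 => [|zs' z] h2 h3' h4; first by move: h2 => /=; lia.
have [y [hy1 hy2 hy3]] := superficial_step h3 h3' h4 h5.
exists (rcons ys y), zs'; split=> //.
- by rewrite size_rcons h1.
- by move: h2; rewrite size_rcons; lia.
- split=> [y'|z' hz'].
    by rewrite mem_rcons inE => /orP[/eqP ->|/h3].
  by apply: h3'; rewrite mem_rcons inE hz' orbT.
Qed.

(** Vanishing gives $I^{n+1}=I^{n+2}+(ys)I^n$, and Nakayama removes $I^{n+2}\subseteq
    \mathfrak{m}I^{n+1}$. *)
Lemma reduction_of_len0 ys n : isub (gen_ideal ys) I ->
  (forall k, (n <= k)%N -> ilen (quot_filt ys k) (ipow I k) 0) ->
  ipow I n.+1 = imul (gen_ideal ys) (ipow I n).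
Proof.
move=> hys h; have hP k := ipow_ideal k hI; have hg := gen_ideal_ideal ys.
have e : quot_filt ys n.+1 = ipow I n.+1.
  by apply: (has_len0_eq (V := R^o)); [exact: hP | apply: h].
apply: isub_antisym; last by rewrite ipowS; apply: imul_mono.
have hA := imul_ideal (ipow I n) hg.
apply: (nakayama Rnoeth mloc hA (hP n.+1)); rewrite -{1}e.
rewrite /quot_filt isumC; apply: isum_mono => //.
by rewrite [ipow I n.+2]ipowS; apply: imul_mono => //; apply: isub_Im.
Qed.

End Reduction.

(** * Powers of ideals generated by regular sequences *)

Section RegularPowers.
Variable R : comNzRingType.
Hypothesis Rnoeth : is_noetherian R.
Variable m : ideal R.
Hypothesis mloc : is_local m.
Implicit Types (A K Q : ideal R) (x y z w b : R) (ys zs : seq R).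

(** For a list with head [y] and ideal $Q$, the tail with [y] in the role of [z] yields
    $(A+Q^{k+1}:y)\subseteq A+Q^k$. The equation is then solved modulo [y], and the multiple of [y]
    left over falls to the induction on [n]. *)
Lemma nzd_pow A ys z n : is_ideal A -> (forall y, y \in ys -> m y) ->
  reg A (rcons ys z) -> nzd (isum A (ipow (gen_ideal ys) n)) z.
Proof.
elim: ys A z n => [|y ys IH] A z n hA hm hreg.
  case: n => [|n]; first by move=> r _; apply: isum_r.
  rewrite gen_nil (_ : ipow izero n.+1 = izero); last first.
    apply: isub_antisym; first exact: imul_subl (@izero_ideal R).
    by move=> x ->; apply: id0; apply/imul_ideal/izero_ideal.
  by rewrite isum0 //; case: hreg.
have [hy hreg'] := hreg; have hp := prin_ideal y; have hAp := isum_ideal hA hp.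
have hg := gen_ideal_ideal ys; have hQ := gen_ideal_ideal (y :: ys).
have hm' x : x \in ys -> m x by move=> hx; apply: hm; rewrite inE hx orbT.
have hQk k := ipow_ideal k hQ; have hgk k := ipow_ideal k hg.
have hgQ k : isub (ipow (gen_ideal ys) k) (ipow (gen_ideal (y :: ys)) k).
  by apply: ipow_mono; rewrite gen_cons; apply: isum_r.
have hyQ : gen_ideal (y :: ys) y by apply: gen_mem; rewrite mem_head.
have hQS k : ipow (gen_ideal (y :: ys)) k.+1 =
    isum (ipow (gen_ideal ys) k.+1) (imul (prin y) (ipow (gen_ideal (y :: ys)) k)).
  by rewrite gen_cons; apply: ipow_isumS.
have hrot : reg A (rcons ys y).
  apply: (reg_cons_rcons Rnoeth mloc) => //; first by apply: hm; rewrite mem_head.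
  by move: hreg; rewrite -cats1 reg_cat // => -[].
have colon k s : isum A (ipow (gen_ideal (y :: ys)) k.+1) (y * s) ->
    isum A (ipow (gen_ideal (y :: ys)) k) s.
  rewrite hQS => -[a [_ [ha [q [_ [hq /(imul_prin _ _ (hQk k)) [t ht ->] ->]]] e]]].
  have : isum A (ipow (gen_ideal ys) k.+1) (s - t).
    by apply: (IH A y k.+1) => //; exists a, q; split=> //; rewrite mulrBr e; ring.
  move=> [a' [q' [ha' hq' e']]]; exists a', (q' + t).
  split=> //; last by rewrite addrA -e' subrK.
  by apply: idD => //; apply: ipow_le (leqnSn k) _ _ => //; apply: hgQ.
elim: n => [|n IHn] r h; first by apply: isum_r.
have [a' [q [[a [_ [ha [t ->] ->]]] hq er]]] :
    isum (isum A (prin y)) (ipow (gen_ideal ys) n.+1) r.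
  apply: (IH (isum A (prin y)) z n.+1) => //.
  move: h; rewrite hQS => -[a [_ [ha [q [u [hq hu ->]]] ->]]].
  rewrite [q + _]addrC addrA; exists (a + u), q; split=> //.
  by exists a, u; split=> //; apply: imul_subl hp _ hu.
have hS k := isum_ideal hA (hQk k).
have /colon/IHn [a2 [q2 [ha2 hq2 e2]]] : isum A (ipow (gen_ideal (y :: ys)) n.+1) (y * (z * t)).
  have -> : y * (z * t) = z * r - (z * a + z * q) by rewrite er; ring.
  apply: idB => //; exists (z * a), (z * q).
  by split=> //; apply: idMl => //; apply: hgQ.
exists (a + a2 * y), (q + y * q2); split.
- by apply: idD => //; apply: idMr.
- by apply: idD; [| apply: hgQ | rewrite ipowS; apply: mem_imul].
- by rewrite er e2; ring.
Qed.

(** The part of the power without a factor [y] is handled by [nzd_pow] for the tail, with [y]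
    rotated to the end. *)
Lemma colon_pow A y ys n s : is_ideal A -> (forall x, x \in y :: ys -> m x) ->
  reg A (y :: ys) -> isum A (ipow (gen_ideal (y :: ys)) n.+1) (y * s) ->
  isum A (ipow (gen_ideal (y :: ys)) n) s.
Proof.
move=> hA hm hreg.
have hp := prin_ideal y; have hg := gen_ideal_ideal ys.
have hQk k := ipow_ideal k (gen_ideal_ideal (y :: ys)).
rewrite [in X in X -> _]gen_cons ipow_isumS // -gen_cons.
move=> [a [_ [ha [q [_ [hq /(imul_prin _ _ (hQk n)) [t ht ->] ->]]] e]]].
have [a' [q' [ha' hq' e']]] : isum A (ipow (gen_ideal ys) n.+1) (s - t).
  apply: (@nzd_pow A ys y n.+1) => //.
  - by move=> x hx; apply: hm; rewrite inE hx orbT.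
  - apply: (reg_cons_rcons Rnoeth mloc) => //; apply: hm; exact: mem_head.
  by exists a, q; split=> //; rewrite mulrBr e; ring.
exists a', (q' + t); split=> //; last by rewrite addrA -e' subrK.
apply: idD => //; rewrite gen_cons.
apply: ipow_mono (isum_r _) _ _ => //; exact: ipow_le hq'.
Qed.

Lemma colon_pow0 y ys n s : (forall x, x \in y :: ys -> m x) ->
  reg izero (y :: ys) -> ipow (gen_ideal (y :: ys)) n.+1 (y * s) ->
  ipow (gen_ideal (y :: ys)) n s.
Proof.
move=> hm hreg; have := @colon_pow _ y ys n s (@izero_ideal R) hm hreg.
by rewrite ![isum izero _]isumC !isum0 //; apply/ipow_ideal/gen_ideal_ideal.
Qed.

Section Leading.
Variables (y1 y2 : R) (ys : seq R).
Hypothesis hm : forall x, x \in [:: y1, y2 & ys] -> m x.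
Hypothesis hreg : reg izero [:: y1, y2 & ys].
Let Q := gen_ideal [:: y1, y2 & ys].

(* In the associated graded ring of Q, a polynomial ring in the classes of the
   generators over R/Q, the form of [y2 ^+ g + rho] is monic in the second
   variable, hence not a zero divisor. *)
Lemma leading_step g rho n b : prin y1 rho -> ipow Q g rho -> ipow Q n b ->
  ipow Q (n + g).+1 (b * (y2 ^+ g + rho)) -> ipow Q n.+1 b.
Proof.
move=> hr1 hrg.
have hQ : is_ideal Q by apply: gen_ideal_ideal.
have hQk k := ipow_ideal k hQ; have hp := prin_ideal y1.
have hg := gen_ideal_ideal (y2 :: ys); have hgk k := ipow_ideal k hg.
have eQ : Q = isum (prin y1) (gen_ideal (y2 :: ys)) by rewrite /Q gen_cons.
have hgQ k : isub (ipow (gen_ideal (y2 :: ys)) k) (ipow Q k).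
  by apply: ipow_mono; rewrite eQ; apply: isum_r.
have hm2 x : x \in y2 :: ys -> m x by move=> hx; apply: hm; rewrite inE hx orbT.
have [_ hreg2] := hreg.
have hphi : ipow Q g (y2 ^+ g + rho).
  apply: idD => //; apply: mem_expr => //; apply: gen_mem.
  by rewrite !inE eqxx orbT.
have hA : is_ideal (isum izero (prin y1)) by apply: isum_ideal; [apply: izero_ideal|].
have eA : isum izero (prin y1) = prin y1 by rewrite isumC isum0.
have sub2 k : isub (ipow Q k.+1) (isum (prin y1) (ipow (gen_ideal (y2 :: ys)) k.+1)).
  rewrite eQ ipow_isumS // isumC; apply: isum_mono => //.
  by apply: imul_subl.
have colon2 g' k s : isum (prin y1) (ipow (gen_ideal (y2 :: ys)) (k + g')) (y2 ^+ g' * s) ->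
    isum (prin y1) (ipow (gen_ideal (y2 :: ys)) k) s.
  elim: g' s => [|g' IHg] s; first by rewrite addn0 mul1r.
  rewrite exprS -mulrA addnS => h; apply: IHg.
  by move: h; rewrite -{1 2}eA; apply: colon_pow.
elim: n b => [|n IH] b hb h; have h2 := sub2 _ _ h.
  have /(colon2 g 1%N) : isum (prin y1) (ipow (gen_ideal (y2 :: ys)) (1 + g)) (y2 ^+ g * b).
    have -> : y2 ^+ g * b = b * (y2 ^+ g + rho) - b * rho by ring.
    apply: idB => //; first exact: isum_ideal.
    by apply: isum_l => //; apply: idMl.
  by rewrite !ipow1 // -eQ.
(* Modulo [y1] the form is [y2 ^+ g], which cancels. So [b] is [t * y1] plus a term of order [n.+2]
   in the other generators, and [t] satisfies the hypotheses one degree lower. *)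
have /(colon2 g n.+2) [_ [b1 [[t ->] hb1 e]]] :
    isum (prin y1) (ipow (gen_ideal (y2 :: ys)) (n.+2 + g)) (y2 ^+ g * b).
  have -> : y2 ^+ g * b = b * (y2 ^+ g + rho) - b * rho by ring.
  apply: idB => //; first exact: isum_ideal.
  by apply: isum_l => //; apply: idMl.
have htn : ipow Q n t.
  apply: colon_pow0 => //; rewrite -/Q.
  have -> : y1 * t = b - b1 by rewrite e; ring.
  by apply: idB => //; apply: ipow_le (leqnSn _) _ _ => //; apply: hgQ.
have ht : ipow Q n.+1 t.
  apply: IH => //; apply: colon_pow0 => //; rewrite -/Q.
  have -> : y1 * (t * (y2 ^+ g + rho)) = b * (y2 ^+ g + rho) - b1 * (y2 ^+ g + rho).
    by rewrite e; ring.
  apply: idB => //; rewrite -!addSn; apply: mem_ipowD => //; exact: hgQ.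
rewrite e; apply: idD => //; last exact: hgQ.
by rewrite mulrC ipowS; apply: mem_imul => //; apply: gen_mem; rewrite mem_head.
Qed.

(** [y1 ^+ e] cancels by [colon_pow0]; then [leading_step] raises the order of [b] one at a time up
    to [n]. *)
Lemma leading_cancel e g rho n b : prin y1 rho -> ipow Q g rho ->
  ipow Q (n + (e + g)) (b * (y1 ^+ e * (y2 ^+ g + rho))) -> ipow Q n b.
Proof.
move=> h1 hg h; have : ipow Q (n + g) (b * (y2 ^+ g + rho)).
  elim: e h => [|e IH]; first by rewrite add0n mul1r.
  rewrite addSn addnS exprS => h; apply: IH; apply: colon_pow0 => //.
  by rewrite -/Q; move: h; congr (ipow Q _ _); ring.
have hQ : is_ideal Q by apply: gen_ideal_ideal.
elim: n {h} => [|n IH] // h; apply: leading_step h1 hg _ (h).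
by apply: IH; apply: (ipow_le hQ (leqnSn _) h).
Qed.

End Leading.

(** A monomial of degree above [size ys * N] has an exponent at least [N.+1]. In [key] the split-off
    power of [y] falls from [N.+1] to 0; with at most [N] factors [y], the tail keeps enough degree
    for the induction. *)
Lemma ipow_pigeonhole ys N n : (size ys * N < n)%N ->
  isub (ipow (gen_ideal ys) n)
    (imul (gen_ideal [seq y ^+ N.+1 | y <- ys]) (ipow (gen_ideal ys) (n - N.+1))).
Proof.
elim: ys n => [|y ys IH] n hn.
  case: n hn => // n _; rewrite gen_nil ipowS => x.
  move/(imul_subl (@izero_ideal R)) ->; apply: id0; apply: imul_ideal.
  by first [exact: gen_ideal_ideal | exact: izero_ideal].
set Q := gen_ideal (y :: ys); set T := imul _ _.
have hp := prin_ideal y; have hg := gen_ideal_ideal ys.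
have hQ : is_ideal Q by apply: gen_ideal_ideal.
have hT : is_ideal T by apply/imul_ideal/gen_ideal_ideal.
have hQk k := ipow_ideal k hQ.
have hyQ : Q y by apply: gen_mem; rewrite mem_head.
have hN : (N.+1 <= n)%N by move: hn => /=; nia.
have key j : (j <= N.+1)%N -> forall x, ipow Q (n - (N.+1 - j)) x -> T (y ^+ (N.+1 - j) * x).
  elim: j => [|j IHj] hj x.
    rewrite subn0 => hx; apply: mem_imul => //.
    by apply: gen_mem; rewrite /= mem_head.
  have e1 : (n - (N.+1 - j.+1) = (n - (N.+1 - j)).+1)%N by lia.
  have e2 : (N.+1 - j = (N.+1 - j.+1).+1)%N by lia.
  rewrite e1 /Q gen_cons ipow_isumS // -gen_cons -/Q.
  move=> [q [_ [hq /(imul_prin _ _ (hQk _)) [t ht ->] ->]]]; rewrite mulrDr.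
  apply: idD => //; last first.
    rewrite mulrA -exprSr -e2; apply: IHj => //; exact: ltnW.
  case: ys IH hn hq @Q @T hg hQ hT hQk hyQ IHj ht => [|y' ys] IH hn hq Q T hg hQ hT hQk hyQ IHj ht.
    move: hq; rewrite gen_nil ipowS => /(imul_subl (@izero_ideal R)) ->.
    by rewrite mulr0; apply: id0.
  have /IH : (size (y' :: ys) * N < (n - (N.+1 - j)).+1)%N by move: hn => /=; nia.
  move=> /(_ _ hq).
  have hid : is_ideal (fun q => T (y ^+ (N.+1 - j.+1) * q)).
    split; first by rewrite mulr0; apply: id0.
      by move=> u v hu hv; rewrite mulrDr; apply: idD.
    by move=> a u hu; rewrite mulrCA; apply: idMl.
  apply: (imul_sub hid) => u v hu hv; rewrite mulrCA; apply: mem_imul.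
    by move: u hu; rewrite /= [gen_ideal (y ^+ _ :: _)]gen_cons; apply: isum_r; apply: prin_ideal.
  have -> : (n - N.+1 = (N.+1 - j.+1) + ((n - (N.+1 - j)).+1 - N.+1))%N.
    by move: hn => /=; nia.
  apply: mem_ipowD => //; first exact: mem_expr.
  by move: v hv; apply: ipow_mono; rewrite /Q [X in isub _ X]gen_cons; apply: isum_r.
move=> x hx; rewrite -[x]mul1r -(expr0 y) -(subnn N.+1); apply: key => //.
by rewrite subnn subn0.
Qed.

Lemma integral_root K n M b : is_ideal K -> (0 < M)%N ->
  ipow K (n * M) (b ^+ M) -> integral_over (ipow K n) b.
Proof.
move=> hK hM hb; exists M, (fun i => if i == M then - b ^+ M else 0).
split=> //; split=> [i hi|].
  have hP := ipow_ideal i (ipow_ideal n hK).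
  case: eqP => [->|_]; last exact: id0.
  by apply: idN; [apply/ipow_ideal/ipow_ideal | rewrite ipowM].
rewrite big_nat_recr //= eqxx subnn mulr1 big_nat_cond big1 ?add0r ?subrr //.
by move=> i /andP[/andP[_ hi] _]; rewrite ltn_eqF // mul0r.
Qed.

(* Almost integral elements are integral: the ideals spanned by the b^j L^(M-j)
   form a graded module squeezed between the powers of L. *)
Lemma integral_almost K n c b : is_ideal K -> (0 < n)%N ->
  (forall M, ipow K (n * M - c) (b ^+ M)) -> integral_over (ipow K n) b.
Proof.
move=> hK hn hb; set L := ipow K n.
have hL : is_ideal L by apply: ipow_ideal.
have hP k := ipow_ideal k hL.
have hbL M : ipow L (M - c) (b ^+ M).
  by rewrite ipowM //; apply: ipow_le (hb M) => //; nia.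
pose W k M : ideal R := fun x => exists l : nat -> R,
  (forall j, (j < k)%N -> ipow L (M - j) (l j)) /\ x = \sum_(j < k) b ^+ j * l j.
have hW k M : is_ideal (W k M).
  split.
  - exists (fun=> 0); split=> [j _|]; first exact: id0.
    by rewrite big1 // => j _; rewrite mulr0.
  - move=> _ _ [l [hl ->]] [l' [hl' ->]]; exists (fun j => l j + l' j).
    split=> [j hj|]; first by apply: idD => //; [apply: hl | apply: hl'].
    by rewrite -big_split; apply: eq_bigr => j _; rewrite mulrDr.
  - move=> a _ [l [hl ->]]; exists (fun j => a * l j).
    split=> [j hj|]; first by apply: idMl => //; apply: hl.
    by rewrite mulr_sumr; apply: eq_bigr => j _; rewrite mulrCA.
have hWS k M x w : (k <= M.+1)%N -> L x -> W k M w -> W k M.+1 (x * w).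
  move=> hk hx [l [hl ->]]; exists (fun j => x * l j).
  split=> [j hj|]; last by rewrite mulr_sumr; apply: eq_bigr => j _; rewrite mulrCA.
  rewrite subSn; last by move: hj; lia.
  by rewrite ipowS; apply: mem_imul => //; apply: hl.
have hWk k M : isub (W k M) (W k.+1 M).
  move=> _ [l [hl ->]]; exists (fun j => if (j < k)%N then l j else 0); split.
    by move=> j _; case: ifP => h; [apply: hl | apply: id0].
  by rewrite big_ord_recr /= ltnn mulr0 addr0; apply: eq_bigr => j _; rewrite ltn_ord.
(* The shift by [c] puts [V M] inside $L^M$, since $b^j$ lies in $L^{j-c}$. *)
pose V M := W (M + c).+1 (M + c)%N.
have [|||M0 hM0] := @graded_stable R Rnoeth L hL V.
- by move=> M; apply: hW.
- move=> M _ [l [hl ->]]; apply: id_sum => // j _.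
  apply: (@ipow_le _ _ (j - c + (M + c - j))) => //.
    by have := ltn_ord j; lia.
  by apply: mem_ipowD => //; apply: hl.
- by move=> M x w hx hw; rewrite /V addSn; apply/hWk/hWS.
(* Here $b^T\in V(M_0+1)\subseteq L\cdot V(M_0)$, and the latter involves only $b^j$ with $j<T$:
   this is an integral equation. *)
set T := (M0.+1 + c)%N.
have hbT : V M0.+1 (b ^+ T).
  exists (fun j => if j == T then 1 else 0); split.
    by move=> j _; case: eqP => [->|_]; [rewrite subnn | apply: id0].
  rewrite big_ord_recr /= eqxx mulr1 big1 ?add0r // => j _.
  by rewrite ltn_eqF ?mulr0.
have [l [hl e]] : W T T (b ^+ T).
  have := hM0 _ (leqnSn _) _ hbT; rewrite subSnn ipow1 //.
  by apply: imul_sub => // x w hx hw; rewrite /T addSn; apply: hWS.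
exists T, (fun i => - l (T - i)%N); split; first by [].
split=> [i /andP[i0 iT]|].
  apply: idN; first exact: hP.
  by rewrite -{1}(subKn iT); apply: hl; rewrite /T in iT *; lia.
rewrite big_add1 /= big_nat_rev /= big_mkord e -big_split /= big1 // => j _.
have -> : (T - (0 + T - j.+1).+1 = j)%N by have := ltn_ord j; lia.
by rewrite mulNr mulrC subrr.
Qed.

End RegularPowers.

(** * Vanishing for normal ideals *)

Section Normal.
Variable R : comNzRingType.
Hypothesis Rnoeth : is_noetherian R.
Variable m : ideal R.
Hypothesis mloc : is_local m.
Implicit Types (x y z w b : R).

Variables (K : ideal R) (y1 y2 : R) (ys' : seq R).
Let ys := [:: y1, y2 & ys'].
Let d := size ys.
Let Q := gen_ideal ys.
Hypothesis hK : is_ideal K.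
Hypothesis hKn : forall n, (0 < n)%N -> integrally_closed (ipow K n).
Hypothesis hKl : forall n, exists l, ilen (ipow K n) unit_ideal l.
Hypothesis hm : forall x, x \in ys -> m x.
Hypothesis hreg : reg izero ys.
Hypothesis hQK : isub Q K.
Hypothesis hKQ : ipow K 4 = imul Q (ipow K 3).

Let hKk k : is_ideal (ipow K k) := ipow_ideal k hK.
Let hQ : is_ideal Q := gen_ideal_ideal ys.
Let hQk k : is_ideal (ipow Q k) := ipow_ideal k hQ.

Lemma normal_int n b : integral_over (ipow K n) b -> ipow K n b.
Proof. by case: n => [|n] //; apply: hKn. Qed.

Lemma normal_root n M b : (0 < M)%N -> ipow K (n * M) (b ^+ M) -> ipow K n b.
Proof. by move=> hM /(integral_root hK hM)/normal_int. Qed.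

Lemma ipow_QK j : isub (ipow Q j) (ipow K j).
Proof. exact: ipow_mono. Qed.

Lemma ipow_KQ3 j : isub (ipow K (j + 3)) (imul (ipow Q j) (ipow K 3)).
Proof. exact: ipow_reduction. Qed.

(** With [ipow_QK]: the [K]-adic and [Q]-adic filtrations differ by a shift of at most 3. *)
Lemma ipow_KQ j : isub (ipow K (j + 3)) (ipow Q j).
Proof. by apply: isub_trans (@ipow_KQ3 j) _; apply: imul_subl. Qed.

Section LeadingForm.
Variables (e g : nat) (rho : R).
Hypotheses (hr1 : prin y1 rho) (hrg : ipow Q g rho).
Let phi := y1 ^+ e * (y2 ^+ g + rho).

(** For $M$-th powers the hypothesis becomes [Q]-adic with a loss of 3 independent of $M$; there
    [phi] cancels, and [integral_almost] and normality absorb the loss. *)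
Lemma leading_normal n b : ipow K (n + (e + g)) (b * phi) -> ipow K n b.
Proof.
case: n => [|n] // h; apply: normal_int; apply: (@integral_almost _ Rnoeth _ _ 3) => // M.
have cancel k c T : ipow Q (k + (e + g) * T) (c * phi ^+ T) -> ipow Q k c.
  elim: T c => [|T IH] c; first by rewrite muln0 addn0 mulr1.
  rewrite exprS mulrA mulnS addnCA addnC => h'; apply: IH.
  have := leading_cancel Rnoeth mloc hm hreg hr1 hrg; apply.
  by move: h'; congr (ipow Q _ _); rewrite /phi; ring.
case: (leqP 3 (n.+1 * M)) => hM; last by rewrite (eqP (ltnW hM)).
apply: ipow_QK; apply: (@cancel _ _ M); apply: ipow_KQ.
rewrite -exprMn; have := mem_ipowX M hK h.
by congr (ipow K _ _); lia.
Qed.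

Lemma leading_normalX n b P : ipow K (n + (e + g) * P) (b * phi ^+ P) -> ipow K n b.
Proof.
elim: P b => [|P IH] b; first by rewrite muln0 addn0 mulr1.
rewrite exprS mulrA mulnS addnCA addnC => h; apply: IH; apply: leading_normal.
by move: h; congr (ipow K _ _); ring.
Qed.

End LeadingForm.

(* [nilM M n] is the set of b whose class in the degree n part of the associated
   graded ring of K has M-th power zero. *)
Definition nilM M n : ideal R := fun b => ipow K (n * M).+1 (b ^+ M).

(** Normality gives additivity without raising the exponent: the [M]-th power of each binomial term
    lies in $K^{(nM+1)M}$, so the term lies in $K^{nM+1}$. *)
Lemma nilM_ideal M n : (0 < M)%N -> is_ideal (nilM M n).
Proof.
move=> hM; split.
- by rewrite /nilM expr0n eqn0Ngt hM; apply: id0.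
- move=> b c hb hc; rewrite /nilM exprDn; apply: id_sum => // i _.
  rewrite -mulr_natl; apply: idMl => //; apply: (normal_root hM).
  rewrite exprMn -!exprM ![(_ * M)%N]mulnC !exprM.
  have -> : (M * (M * n).+1 = (n * M).+1 * (M - i) + (n * M).+1 * i)%N.
    by rewrite -mulnDr subnK ?[(M * _.+1)%N]mulnC ?[(M * n)%N]mulnC // -ltnS.
  by apply: mem_ipowD => //; apply: mem_ipowX.
- by move=> a b hb; rewrite /nilM exprMn; apply: idMl.
Qed.

Lemma nilM_mul M k n x b : ipow K k x -> nilM M n b -> nilM M (k + n) (x * b).
Proof.
move=> hx hb; rewrite /nilM exprMn mulnDl -addnS; apply: mem_ipowD => //.
exact: mem_ipowX.
Qed.

Lemma nilM_dvd M M' n b : (0 < M')%N -> (M %| M')%N -> nilM M n b -> nilM M' n b.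
Proof.
move=> hM' /dvdnP [t e] hb; rewrite /nilM e [(t * M)%N]mulnC exprM.
have ht : (0 < t)%N by case: t e hM' => // ->.
by apply: ipow_le (mem_ipowX t hK hb) => //; nia.
Qed.

Lemma nilM_sub M n : (0 < M)%N -> isub (nilM M n) (ipow K n).
Proof. by move=> hM b hb; apply: (normal_root hM); apply: ipow_le hb. Qed.

Lemma nilM_ipow M n : (0 < M)%N -> isub (ipow K n.+1) (nilM M n).
Proof.
by move=> hM b hb; apply: ipow_le (mem_ipowX M hK hb) => //; nia.
Qed.

(** Exponents run through factorials because each divides the next: the ideals then increase, and
    [graded_acc] stops them in all degrees at once. *)
Lemma nilM_uniform : exists2 D, (0 < D)%N &
  forall M n b, (0 < M)%N -> nilM M n b -> nilM D n b.
Proof.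
have [||||k0 hk0] := @graded_acc R Rnoeth K hK (fun k n => nilM k.+1`! n).
- by move=> k n; apply: nilM_ideal; apply: fact_gt0.
- by move=> k n; apply: nilM_sub; apply: fact_gt0.
- by move=> k n x w hx; apply: (@nilM_mul _ 1); rewrite ipow1.
- move=> k n b; apply: nilM_dvd; first exact: fact_gt0.
  by rewrite [k.+2`!]factS dvdn_mull.
exists (k0.+1)`!; first exact: fact_gt0.
move=> M n b hM hb; apply: (hk0 M.-1); rewrite prednK //.
by apply: nilM_dvd hb; [apply: fact_gt0 | apply: dvdn_fact; rewrite hM leqnn].
Qed.

(** Otherwise adjoining the [u k] to [A] gives [l.+1] strict steps. The coefficient 1 at [u k] later
    makes the form in [y1], [y2] monic. *)
Lemma len_dep A l (u : nat -> R) : is_ideal A -> ilen A unit_ideal l ->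
  exists k (r : nat -> R), (k <= l)%N /\ A (u k - \sum_(j < k) r j * u j).
Proof.
move=> hA [_ hl]; apply: NNPP => hno; apply: hl.
pose fix U k : ideal R := if k is k'.+1 then isum (U k') (prin (u k')) else A.
have hU k : is_ideal (U k).
  by elim: k => [|k IH] //; apply: isum_ideal => //; apply: prin_ideal.
have UE k x : U k x -> exists r : nat -> R, A (x - \sum_(j < k) r j * u j).
  elim: k x => [|k IH] x; first by exists (fun=> 0); rewrite big_ord0 subr0.
  move=> [v [_ [/IH [r hr] [t ->] ->]]].
  exists (fun j => if j == k then t else r j); rewrite big_ord_recr /= eqxx.
  rewrite (eq_bigr (fun j : 'I_k => r j * u j)); last first.
    by move=> j _; rewrite ltn_eqF.
  by rewrite opprD addrACA subrr addr0.
have key k : (k <= l.+1)%N -> lge (V := R^o) k (U (l.+1 - k)%N) unit_ideal.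
  elim: k => [|k IH] hk //.
  exists (U (l.+1 - k)%N); have e : (l.+1 - k = (l.+1 - k.+1).+1)%N by lia.
  split; [exact: hU | | | by apply: IH; apply: ltnW].
    by rewrite e /=; apply: isum_l; apply: prin_ideal.
  exists (u (l.+1 - k.+1)%N).
    by rewrite e /=; apply: isum_r; [apply: hU | apply: prin_mem].
  move=> /UE [r hr]; apply: hno; exists (l.+1 - k.+1)%N, r; split=> //.
  by rewrite subSS leq_subr.
by have := key l.+1 (leqnn _); rewrite subnn.
Qed.

(** * Cocycles of the first Koszul map *)

Section Cocycle.
Variable a : nat -> R.
Hypothesis ha : forall i j, (i < d)%N -> (j < d)%N ->
  ipow K 2 (a i * ys`_j - a j * ys`_i).

Definition ord_ge N h : Prop := forall i, (i < d)%N -> ipow K h (a i ^+ N).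

Lemma ys_mem i : (i < d)%N -> K ys`_i.
Proof. by move=> hi; apply/hQK/gen_mem/mem_nth. Qed.

(** The difference of powers has the factor $a_iy_j-a_jy_i\in K^2$. In the [N]-th power of a summand
    this contributes $2N$ where $h+N$ is due: a surplus of $N-h>0$. *)
Lemma cocycle_exp N h i j : (0 < N)%N -> (h < N)%N -> ord_ge N h ->
  (i < d)%N -> (j < d)%N ->
  nilM N (h + N) (a i ^+ N * ys`_j ^+ N - a j ^+ N * ys`_i ^+ N).
Proof.
move=> hN hh hA hi hj; rewrite -!exprMn subrXX mulr_sumr.
apply: id_sum => [|k _]; first exact: nilM_ideal.
change (nilM N (h + N) ((a i * ys`_j - a j * ys`_i) *
  ((a i * ys`_j) ^+ (N.-1 - k) * (a j * ys`_i) ^+ k))).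
rewrite /nilM exprMn [X in _ * X]exprMn -!exprM ![(_ * N)%N]mulnC !exprM.
have hk := ltn_ord k.
have -> : (N * (h + N)).+1 =
   (2 * N + ((h + N) * (N.-1 - k) + (h + N) * k) - (N - h).-1)%N by nia.
apply: (@ipow_le _ _ (2 * N + ((h + N) * (N.-1 - k) + (h + N) * k))) => //.
  exact: leq_subr.
have hX i' j' : (i' < d)%N -> (j' < d)%N -> ipow K (h + N) ((a i' * ys`_j') ^+ N).
  move=> hi' hj'; rewrite exprMn; apply: mem_ipowD => //; first exact: hA.
  by apply: mem_expr => //; apply: ys_mem.
apply: mem_ipowD => //; first by apply: mem_ipowX => //; apply: ha.
by apply: mem_ipowD => //; apply: mem_ipowX => //; apply: hX.
Qed.

(** [w'] stands for $w\,a_j^N/y_j^N$, for all [j] at once: write $w=\sum y_i^Nc_i$ by the pigeonhole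
    and replace each $y_i^N$ by $a_i^N$. *)
Lemma divide_step N h k w : (0 < N)%N -> (h < N)%N -> ord_ge N h ->
  (d * N + 3 <= k + N)%N -> ipow K (k + N) w ->
  exists2 w', ipow K (k + h) w' & forall j, (j < d)%N ->
    nilM N (k + N + h) (ys`_j ^+ N * w' - a j ^+ N * w).
Proof.
move=> hN hh hA hk hw.
have : imul (gen_ideal [seq y ^+ N | y <- ys]) (ipow K k) w.
  have hg := gen_ideal_ideal [seq y ^+ N | y <- ys].
  have e : (k + N = (k + N - 3) + 3)%N by lia.
  move: w hw; rewrite e; apply: isub_trans (@ipow_KQ3 _) _.
  apply: isub_trans (imul_mono _ (isub_refl (I := ipow K 3))) _.
    apply: (@ipow_pigeonhole _ _ N.-1).
    have hd : (2 <= d)%N by [].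
    have e' : (d * N.-1 + d = d * N)%N by rewrite -mulnSr prednK.
    rewrite -/d; move: hk hd e'; lia.
  rewrite prednK // -imulA; [|exact: hg|exact: hQk|exact: hKk].
  apply: imul_mono => //; apply: isub_trans (imul_mono (@ipow_QK _) (isub_refl (I := ipow K 3))) _.
  by rewrite -ipowD //; apply: ipow_le => //; lia.
move=> /(imul_gen (hKk k)) [c [hc e]]; rewrite size_map -/d in e.
exists (\sum_(i < d) a i ^+ N * c i).
  apply: id_sum => // i _; rewrite addnC; apply: mem_ipowD => //.
  by apply: hA.
move=> j hj; rewrite e !mulr_sumr -sumrB; apply: id_sum => [|i _].
  exact: nilM_ideal.
rewrite (nth_map 0) //.
have -> : ys`_j ^+ N * (a i ^+ N * c i) - a j ^+ N * (ys`_i ^+ N * c i) =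
  c i * (a i ^+ N * ys`_j ^+ N - a j ^+ N * ys`_i ^+ N) by ring.
have -> : (k + N + h = k + (h + N))%N by lia.
by apply: nilM_mul => //; apply: cocycle_exp.
Qed.

(** Each division lowers the degree by [N - h]; from degree [d * N + 3] on [divide_step] applies. *)
Lemma divide_iter N h M w j : (0 < N)%N -> (h < N)%N -> ord_ge N h -> (j < d)%N ->
  ipow K (d * N + 3 + (N - h) * M) w ->
  exists2 w', ipow K (d * N + 3) w' &
    nilM N (d * N + 3 + N * M) (ys`_j ^+ (N * M) * w' - a j ^+ (N * M) * w).
Proof.
move=> hN hh hA hj; have hid n := @nilM_ideal N n hN.
elim: M w => [|M IH] w hw.
  exists w; first by move: hw; rewrite muln0 addn0.
  by rewrite !muln0 subrr; apply: id0.
set c := (d * N + 3)%N in IH hw *.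
have hd : (2 <= d)%N by [].
have e1 : (c + (N - h) * M.+1 = (c + (N - h) * M - h) + N)%N by rewrite /c; nia.
rewrite e1 in hw.
have [|w1 hw1 h1] := divide_step hN hh hA _ hw; first by rewrite /c; nia.
have e2 : (c + (N - h) * M - h + h = c + (N - h) * M)%N by rewrite /c; nia.
rewrite e2 in hw1.
have [w' hw' h2] := IH w1 hw1; exists w' => //.
have -> : ys`_j ^+ (N * M.+1) * w' - a j ^+ (N * M.+1) * w =
   ys`_j ^+ N * (ys`_j ^+ (N * M) * w' - a j ^+ (N * M) * w1) +
   a j ^+ (N * M) * (ys`_j ^+ N * w1 - a j ^+ N * w).
  by rewrite mulnS !exprD; ring.
apply: idD => //.
  have -> : (c + N * M.+1 = N + (c + N * M))%N by lia.
  by apply: nilM_mul => //; apply: mem_expr => //; apply: ys_mem.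
have -> : (c + N * M.+1 = h * M + (c + (N - h) * M - h + N + h))%N by rewrite /c; nia.
apply: nilM_mul; last exact: h1.
by rewrite exprM; apply: mem_ipowX => //; apply: hA.
Qed.

(* The monomials in y1, y2 of large degree outnumber the length of R/K^(c+1), so
   after dividing as in [divide_iter] some relation between them survives. *)
Lemma cocycle_nil N h j : (0 < N)%N -> (h < N)%N -> ord_ge N h -> (j < d)%N ->
  exists2 M, (0 < M)%N & nilM M h (a j ^+ N).
Proof.
move=> hN hh hA hj; have hid n := @nilM_ideal N n hN.
set c := (d * N + 3)%N.
(* There are [n.+1 > l] monomials of degree [n], and [M] divisions bring that degree down to [c]. *)
have [l hl] := hKl c.+1; set M := l.+1; set n := (c + (N - h) * M)%N.
have hln : (l <= n)%N by rewrite /n /M; nia.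
have hmon k : (k <= n)%N -> ipow Q n (y1 ^+ (n - k) * y2 ^+ k).
  move=> hk; rewrite -{1}(subnK hk); apply: mem_ipowD => //; apply: mem_expr => //.
    by apply: gen_mem; rewrite mem_head.
  by apply: gen_mem; rewrite !inE eqxx orbT.
have hdiv k : exists w', (k <= n)%N -> ipow K c w' /\
    nilM N (c + N * M) (ys`_j ^+ (N * M) * w' - a j ^+ (N * M) * (y1 ^+ (n - k) * y2 ^+ k)).
  case: (leqP k n) => hk; last by exists 0.
  have [w' h1 h2] := divide_iter hN hh hA hj (ipow_QK (hmon k hk)).
  by exists w'.
pose u k := sval (constructive_indefinite_description _ (hdiv k)).
have hu k : (k <= n)%N -> ipow K c (u k) /\
    nilM N (c + N * M) (ys`_j ^+ (N * M) * u k - a j ^+ (N * M) * (y1 ^+ (n - k) * y2 ^+ k)).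
  by rewrite /u; case: constructive_indefinite_description.
have [k [r [hkl hdep]]] := len_dep u (hKk c.+1) hl.
have hkn : (k <= n)%N := leq_trans hkl hln.
pose rho := - \sum_(i < k) r i * (y1 ^+ (k - i) * y2 ^+ i).
have hr1 : prin y1 rho.
  apply: idN; first exact: prin_ideal.
  apply: id_sum => [|i _]; first exact: prin_ideal.
  apply: idMl; first exact: prin_ideal.
  exists (y1 ^+ (k - i.+1) * y2 ^+ i); rewrite -{1}(subnSK (ltn_ord i)) exprS; ring.
have hrk : ipow Q k rho.
  apply: idN => //; apply: id_sum => // i _; apply: idMl => //.
  have hi := ltnW (ltn_ord i); rewrite -{1}(subnK hi).
  apply: mem_ipowD => //; apply: mem_expr => //.
    by apply: gen_mem; rewrite mem_head.
  by apply: gen_mem; rewrite !inE eqxx orbT.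
set phi := y1 ^+ (n - k) * (y2 ^+ k + rho).
set kap := u k - _ in hdep.
have ephi : phi = y1 ^+ (n - k) * y2 ^+ k -
    \sum_(i < k) r i * (y1 ^+ (n - i) * y2 ^+ i).
  rewrite /phi mulrDr mulrN mulr_sumr; congr (_ - _); apply: eq_bigr => i _.
  have hi := ltnW (ltn_ord i).
  have -> : (n - i = (n - k) + (k - i))%N by lia.
  by rewrite exprD; ring.
(* [kap] lies in $K^{c+1}$, one degree above the quotients [u k], so its multiple vanishes modulo
   nilpotents and only the multiple of [phi] remains. *)
have hnil : nilM N (c + N * M) (a j ^+ (N * M) * phi).
  have -> : a j ^+ (N * M) * phi = ys`_j ^+ (N * M) * kap -
     ((ys`_j ^+ (N * M) * u k - a j ^+ (N * M) * (y1 ^+ (n - k) * y2 ^+ k)) -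
      \sum_(i < k) r i * (ys`_j ^+ (N * M) * u i -
                          a j ^+ (N * M) * (y1 ^+ (n - i) * y2 ^+ i))).
    have -> : \sum_(i < k) r i * (ys`_j ^+ (N * M) * u i -
                  a j ^+ (N * M) * (y1 ^+ (n - i) * y2 ^+ i)) =
        ys`_j ^+ (N * M) * (\sum_(i < k) r i * u i) -
        a j ^+ (N * M) * (\sum_(i < k) r i * (y1 ^+ (n - i) * y2 ^+ i)).
      rewrite !mulr_sumr -sumrB; apply: eq_bigr => i _; ring.
    rewrite ephi /kap; ring.
  apply: idB => //; last apply: idB => //.
  - apply: nilM_ipow => //.
    have -> : (c + N * M).+1 = (N * M + c.+1)%N by lia.
    apply: mem_ipowD => //; apply: mem_expr => //; exact: ys_mem.
  - by case: (hu k hkn).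
  - apply: id_sum => // i _; apply: idMl => //.
    by case: (hu i) => //; have := ltn_ord i; lia.
(* Since $c+NM=hM+n$, cancelling [phi ^+ N], of degree $nN$, leaves $a_j^{NMN}$ in degree
   $hMN+1$. *)
exists (M * N)%N; first by rewrite /M; nia.
rewrite /nilM; apply: (@leading_normalX (n - k) k rho hr1 hrk _ _ N).
have e3 : (c + N * M = h * M + n)%N by rewrite /n; nia.
have e4 : ((c + N * M) * N).+1 = ((h * (M * N)).+1 + (n - k + k) * N)%N.
  by rewrite subnK // e3 mulnDl mulnA addSn.
by rewrite -/phi -e4 -exprM mulnA; move: hnil; rewrite /nilM exprMn -exprM.
Qed.

Lemma ord_geM N h t : ord_ge N h -> ord_ge (N * t) (h * t).
Proof. by move=> h1 i hi; rewrite exprM; apply: mem_ipowX => //; apply: h1. Qed.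

Lemma ord_ge_root N h t : (0 < t)%N -> ord_ge (N * t) (h * t) -> ord_ge N h.
Proof. by move=> ht h1 i hi; apply: (normal_root ht); rewrite -exprM; apply: h1. Qed.

Lemma ord_ge_le N h h' : (h' <= h)%N -> ord_ge N h -> ord_ge N h'.
Proof. by move=> hh h1 i hi; apply: ipow_le (h1 i hi). Qed.

(** The fractions $(h+jh')/(N+jN')$ tend to $h'/N'$, so powers miss the bound of the limit by a
    bounded amount, as [integral_almost] permits. *)
Lemma ord_ge_closed N h N' h' : (0 < N')%N -> (h' * N = h * N' + 1)%N ->
  (forall j, ord_ge (N + j * N') (h + j * h')) -> ord_ge N' h'.
Proof.
move=> N'0 e hj i hi; have h'0 : (0 < h')%N by case: h' e {hj} => //; rewrite addn1.
(* In the constant, [h' * N] covers [M < N], [h' * N'] the remainder of [M - N] modulo [N'], and 1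
   the determinant [e]. *)
apply: normal_int; apply: (@integral_almost _ Rnoeth _ _ (h' * N + h' * N' + 1)) => // M.
case: (leqP N M) => hM; last first.
  by have -> : (h' * M - (h' * N + h' * N' + 1) = 0)%N by nia.
pose j := ((M - N) %/ N')%N; pose r := ((M - N) %% N')%N.
have eM : (M = N + j * N' + r)%N by rewrite /j /r -addnA -divn_eq subnKC.
have hr : (r < N')%N by rewrite /r ltn_mod.
have hX := mem_ipowX N' hK (hj j i hi).
rewrite {2}eM exprD; apply: idMr => //.
rewrite -exprM (mulnC (N + j * N')) exprM in hX.
apply: ipow_le hX => //; rewrite {1}eM.
have e2 : (h' * (N + j * N' + r) = h * N' + 1 + j * h' * N' + h' * r)%N.
  by rewrite !mulnDr e; ring.
have e3 : (h' * r <= h' * N')%N by rewrite leq_mul2l (ltnW hr) orbT.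
have e4 : ((h + j * h') * N' = h * N' + j * h' * N')%N by rewrite mulnDl.
rewrite e2 e e4; move: e3; lia.
Qed.

Lemma cocycle_trivial i : (i < d)%N -> K (a i).
Proof.
suff: ord_ge 1 1 by move=> h /h; rewrite expr1 ipow1.
apply: NNPP => h11; have [D hD hDn] := nilM_uniform.
have hlt N h : (0 < N)%N -> ord_ge N h -> (h < N)%N.
  move=> hN hA; rewrite ltnNge; apply/negP => hh; apply: h11.
  by apply: (@ord_ge_root 1 1 N) => //; rewrite !mul1n; apply: ord_ge_le hA.
have hstep N h : (0 < N)%N -> ord_ge N h -> ord_ge (N * D) (h * D + 1).
  move=> hN hA j hj; have [M hM hM'] := cocycle_nil hN (hlt N h hN hA) hA hj.
  by rewrite exprM addn1; apply: hDn hM'.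
(* $h'/N'$ exceeds $h/N$ by $1/(NN')$, which is within the gain $1/(ND)$ once [N' >= D]. *)
have hbd N h N' h' : (0 < N)%N -> ord_ge N h -> ~ ord_ge N' h' ->
    (h' * N = h * N' + 1)%N -> (N' < D)%N.
  move=> hN hA hA' e; rewrite ltnNge; apply/negP => hDN'; apply: hA'.
  apply: (@ord_ge_root _ _ (N * D)); first by rewrite muln_gt0 hN.
  rewrite [(N' * _)%N]mulnC; apply: ord_ge_le (ord_geM N' (hstep N h hN hA)).
  nia.
(* Stern-Brocot descent: h/N lies below the common order of the a_i and h'/N'
   above it, and the denominator N' grows. *)
have descent t : exists N h N' h', [/\ (0 < N)%N, ord_ge N h, ~ ord_ge N' h',
    (h' * N = h * N' + 1)%N & (t < N')%N].
  elim: t => [|t [N [h [N' [h' [hN hA hA' e ht]]]]]].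
    by exists 1%N, 0%N, 1%N, 1%N; split.
  (* By [ord_ge_closed] the mediants cannot all bound the order from below, so a success is followed
     by a failure; the two again have determinant 1. *)
  have [j hjA hjA'] : exists2 j, ord_ge (N + j * N') (h + j * h') &
      ~ ord_ge (N + j.+1 * N') (h + j.+1 * h').
    apply: NNPP => hno; apply: hA'; apply: (@ord_ge_closed N h) => //.
      exact: leq_ltn_trans ht.
    elim=> [|j IH]; first by rewrite !mul0n !addn0.
    by apply: NNPP => h'j; apply: hno; exists j.
  exists (N + j * N')%N, (h + j * h')%N, (N + j.+1 * N')%N, (h + j.+1 * h')%N.
  split=> //; first by rewrite addn_gt0 hN.
    nia.
  nia.
have [N [h [N' [h' [hN hA hA' e ht]]]]] := descent D.
by have := hbd N h N' h' hN hA hA' e; rewrite ltnNge ltnW.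
Qed.

End Cocycle.
End Normal.

(** * The Koszul complex *)

Section Koszul.
Variable R : comNzRingType.
Hypothesis Rnoeth : is_noetherian R.
Variable m : ideal R.
Hypothesis mloc : is_local m.
Implicit Types (x y : R).

Let R4 : lmodType R := (R^o * R^o * R^o * R^o)%type.
Let R6 : lmodType R := (R^o * R^o * R^o * R^o * R^o * R^o)%type.

Variables y1 y2 y3 y4 : R.

Definition kos1 (a : R4) : R6 := let: (a1, a2, a3, a4) := a in
  (y1 * a2 - y2 * a1, y1 * a3 - y3 * a1, y1 * a4 - y4 * a1,
   y2 * a3 - y3 * a2, y2 * a4 - y4 * a2, y3 * a4 - y4 * a3).
(** The target is indexed by the missing variable with the signs absorbed, so [kos3] is plainly
    $\sum y_ib_i$. *)
Definition kos2 (c : R6) : R4 := let: (c12, c13, c14, c23, c24, c34) := c in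
  (- y2 * c34 + y3 * c24 - y4 * c23, y1 * c34 - y3 * c14 + y4 * c13,
   - y1 * c24 + y2 * c14 - y4 * c12, y1 * c23 - y2 * c13 + y3 * c12).
Definition kos3 (b : R4) : R^o := let: (b1, b2, b3, b4) := b in
  y1 * b1 + y2 * b2 + y3 * b3 + y4 * b4.

Lemma scale_regular (r x : R) : r *: (x : R^o) = r * x :> R.
Proof. by []. Qed.

Lemma kos1_linear : linear kos1.
Proof.
move=> r [[[a1 a2] a3] a4] [[[b1 b2] b3] b4].
by do ?apply: injective_projections; rewrite /= !scale_regular; ring.
Qed.
HB.instance Definition _ := GRing.isLinear.Build R R4 R6 _ kos1 kos1_linear.

Lemma kos2_linear : linear kos2.
Proof.
move=> r [[[[[a1 a2] a3] a4] a5] a6] [[[[[b1 b2] b3] b4] b5] b6].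
by do ?apply: injective_projections; rewrite /= !scale_regular; ring.
Qed.
HB.instance Definition _ := GRing.isLinear.Build R R6 R4 _ kos2 kos2_linear.

Lemma kos3_linear : linear kos3.
Proof.
move=> r [[[a1 a2] a3] a4] [[[b1 b2] b3] b4].
by rewrite /= !scale_regular; ring.
Qed.
HB.instance Definition _ := GRing.isLinear.Build R R4 R^o _ kos3 kos3_linear.

Definition pow4 (A : ideal R) : R4 -> Prop :=
  @mprod R _ R^o (@mprod R _ R^o (@mprod R R^o R^o A A) A) A.
Definition pow6 (A : ideal R) : R6 -> Prop :=
  @mprod R _ R^o (@mprod R _ R^o (pow4 A) A) A.

Lemma pow4I (A : ideal R) a b c e : A a -> A b -> A c -> A e -> pow4 A (a, b, c, e).
Proof. by []. Qed.
Lemma pow6I (A : ideal R) a b c e f g : A a -> A b -> A c -> A e -> A f -> A g ->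
  pow6 A (a, b, c, e, f, g).
Proof. by []. Qed.

Lemma pow4_submod A : is_ideal A -> submod (pow4 A).
Proof. by move=> hA; do !apply: mprod_submod. Qed.
Lemma pow6_submod A : is_ideal A -> submod (pow6 A).
Proof. by move=> hA; do !apply: mprod_submod. Qed.

Lemma pow4_len A l : is_ideal A -> ilen A unit_ideal l ->
  has_len (pow4 A) (@mfull R R4) (4 * l).
Proof.
move=> hA hl; have -> : (4 * l = l + l + l + l)%N by lia.
have sA := submod_ideal hA; have s2 := mprod_submod sA sA.
have h2 := has_len_prod sA sA hl hl.
have h3 := has_len_prod s2 sA h2 hl.
exact: (has_len_prod (mprod_submod s2 sA) sA h3 hl).
Qed.

Lemma pow6_len A l : is_ideal A -> ilen A unit_ideal l ->
  has_len (pow6 A) (@mfull R R6) (6 * l).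
Proof.
move=> hA hl; have -> : (6 * l = 4 * l + l + l)%N by lia.
have sA := submod_ideal hA; have s4 := pow4_submod hA.
have h5 := has_len_prod s4 sA (pow4_len hA hl) hl.
exact: (has_len_prod (mprod_submod s4 sA) sA h5 hl).
Qed.

Let Q := gen_ideal [:: y1; y2; y3; y4].
Hypothesis hreg : reg izero [:: y1; y2; y3; y4].

(** Regularity of [y4] puts [b4] into $(y_1,y_2,y_3)$; substituting leaves a shorter relation,
    treated likewise with [y3], [y2], [y1]. The coefficients met form the preimage. *)
Lemma kos_exact (b : R4) : kos3 b = 0 -> exists c, b = kos2 c.
Proof.
case: b => [[[b1 b2] b3] b4] /= e.
have [h1 [h2 [h3 [h4 _]]]] := hreg.
have [_ [_ [[_ [_ [[_ [_ [-> [al ->] ->]]] [be ->] ->]]] [ga ->] e4]]] :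
    isum (isum (isum izero (prin y1)) (prin y2)) (prin y3) b4.
  apply: h4; exists (0 + - b1 * y1 + - b2 * y2), (- b3 * y3).
  split; last by apply/eqP; rewrite -subr_eq0; apply/eqP; rewrite -[RHS]e; ring.
    exists (0 + - b1 * y1), (- b2 * y2); split=> //; last by exists (- b2).
    by exists 0, (- b1 * y1); split=> //; exists (- b1).
  by exists (- b3).
have [_ [_ [[_ [_ [-> [de ->] ->]]] [ep ->] e3]]] :
    isum (isum izero (prin y1)) (prin y2) (b3 + ga * y4).
  apply: h3; exists (0 + - (b1 + al * y4) * y1), (- (b2 + be * y4) * y2).
  split; last by apply/eqP; rewrite -subr_eq0; apply/eqP; rewrite -[RHS]e e4; ring.
    exists 0, (- (b1 + al * y4) * y1); split=> //; by exists (- (b1 + al * y4)).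
  by exists (- (b2 + be * y4)).
have e3' : b3 = de * y1 + ep * y2 - ga * y4 by rewrite -[b3](addrK (ga * y4)) e3; ring.
have [_ [_ [-> [ze ->] e2]]] : isum izero (prin y1) (b2 + be * y4 + ep * y3).
  apply: h2; exists 0, (- (b1 + al * y4 + de * y3) * y1).
  split=> //; last by apply/eqP; rewrite -subr_eq0; apply/eqP; rewrite -[RHS]e e4 e3'; ring.
  by exists (- (b1 + al * y4 + de * y3)).
have e2' : b2 = ze * y1 - be * y4 - ep * y3.
  by rewrite -[b2](addrK (be * y4 + ep * y3)) addrA e2; ring.
have e1 : izero (b1 + al * y4 + de * y3 + ze * y2).
  by apply: h1; rewrite /izero -e e4 e3' e2'; ring.
have e1' : b1 = - al * y4 - de * y3 - ze * y2.
  by rewrite -[b1](addrK (al * y4 + de * y3 + ze * y2)) !addrA e1; ring.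
exists (ga, - be, ep, al, - de, ze).
by rewrite e1' e2' e3' e4 /=; congr (_, _, _, _); ring.
Qed.

Variable K : ideal R.
Hypothesis hK : is_ideal K.
Hypothesis hKn : forall n, (0 < n)%N -> integrally_closed (ipow K n).
Hypothesis hKl : forall n, exists l, ilen (ipow K n) unit_ideal l.
Hypothesis hm : forall x, x \in [:: y1; y2; y3; y4] -> m x.
Hypothesis hQK : isub Q K.
Hypothesis hKQ : ipow K 4 = imul Q (ipow K 3).

Let hKk k : is_ideal (ipow K k) := ipow_ideal k hK.
Let hQ : is_ideal Q := gen_ideal_ideal _.

(** In the notation below $6H_2=a+u$, $4H_3=u+q$ and $H_4=q+l$, so $H_4+6H_2-4H_3-4H_1=l+(a-4H_1)$;
    the bracket is the length of the cohomology at $(R/K^2)^6$. *)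
Lemma koszul_bound H1 H2 H3 H4 : ilen (ipow K 1) unit_ideal H1 ->
  ilen (ipow K 2) unit_ideal H2 -> ilen (ipow K 3) unit_ideal H3 ->
  ilen (ipow K 4) unit_ideal H4 ->
  exists2 l, ilen Q unit_ideal l & (4 * H1 + 4 * H3 + l <= 6 * H2 + H4)%N.
Proof.
move=> h1 h2 h3 h4.
have hyK x : x \in [:: y1; y2; y3; y4] -> K x by move=> hx; apply/hQK/gen_mem.
have [Ky1 Ky2 Ky3 Ky4] : [/\ K y1, K y2, K y3 & K y4].
  by split; apply: hyK; rewrite !inE eqxx ?orbT.
have hT := @unit_ideal_ideal R.
have [||q [l [hq hl e4]]] := ilen_split (hKk 4) hQ hT _ _ h4.
- by rewrite hKQ; apply: imul_subl.
- by [].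
exists l => //.
have s6 := pow6_submod (hKk 2); have s4 := pow4_submod (hKk 3).
have f4 := mfull_submod R4; have f6 := mfull_submod R6.
pose U := mpre kos2 (@mfull R R6) (pow4 (ipow K 3)).
have sU : submod U by apply: mpre_submod.
have KS n x y : K x -> ipow K n y -> ipow K n.+1 (x * y).
  by move=> hx hy; rewrite ipowS; apply: mem_imul.
have KSN n x y : K x -> ipow K n y -> ipow K n.+1 (- x * y).
  by move=> hx hy; rewrite mulNr; apply: idN => //; apply: KS.
have s6U : msub (pow6 (ipow K 2)) U.
  move=> [[[[[c1 c2] c3] c4] c5] c6] [[[[[k1 k2] k3] k4] k5] k6].
  split=> //; apply: pow4I.
  - by apply: idB => //; [apply: idD => //; [apply: KSN|apply: KS]|apply: KS].
  - by apply: idD => //; [apply: idB => //; apply: KS|apply: KS].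
  - by apply: idB => //; [apply: idD => //; [apply: KSN|apply: KS]|apply: KS].
  - by apply: idD => //; [apply: idB => //; apply: KS|apply: KS].
have [a [u [hla hlu e6]]] :=
  has_len_split s6 sU f6 s6U (fun _ _ => I) (pow6_len (hKk 2) h2).
have aH1 : (4 * H1 <= a)%N.
  have hp4 := pow4_len (hKk 1) h1.
  have e1 : pow4 (ipow K 1) = mpre kos1 (@mfull R R4) (pow6 (ipow K 2)).
    apply: mset_ext; move=> [[[a1 a2] a3] a4].
      move=> [[[k1 k2] k3] k4]; split=> //.
      by apply: pow6I; apply: idB => //; apply: KS.
    move=> [_ [[[[[k12 k13] k14] k23] k24] k34]].
    pose al i : R := nth (0 : R) [:: (a1 : R); a2; a3; a4] i.
    have hcoc i j : (i < 4)%N -> (j < 4)%N ->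
        ipow K 2 (al i * [:: y1; y2; y3; y4]`_j - al j * [:: y1; y2; y3; y4]`_i).
      wlog hij : i j / (i <= j)%N.
        move=> h hi hj; case: (leqP i j) => hij; first exact: h.
        by rewrite -opprB; apply: idN => //; apply: h => //; apply: ltnW.
      have hN x y z t : ipow K 2 (x * y - z * t) -> ipow K 2 (t * z - y * x).
        by move=> h; rewrite -opprB mulrC [t * z]mulrC; apply: idN.
      case: i hij => [|[|[|[|i]]]] // + _; case: j => [|[|[|[|j]]]] // _ _;
        first [by rewrite subrr; exact: (id0 (hKk 2)) | apply: hN].
      + exact: k12.
      + exact: k13.
      + exact: k14.
      + exact: k23.
      + exact: k24.
      + exact: k34.
    have hal := cocycle_trivial Rnoeth mloc hK hKn hKl hm hreg hQK hKQ hcoc.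
    rewrite ipow1 //; split; first split; first split.
    - exact: (hal 0%N).
    - exact: (hal 1%N).
    - exact: (hal 2%N).
    - exact: (hal 3%N).
  rewrite e1 in hp4.
  have {}hp4 := proj1 (@has_len_pre R R4 R6 kos1 _ f4 _ _ s6) hp4.
  have [] := has_len_subr s6 (mimg_submod kos1 s6 f4) sU _ _ hla.
  - by move=> z hz; exists 0, z; rewrite linear0 add0r.
  - move=> _ [x [z [_ hz ->]]]; split=> //.
    have [_ uD _] := sU; have [] : U (kos1 x + z); last by [].
    apply: uD; last exact: s6U.
    split=> //; case: x => [[[a1 a2] a3] a4].
    have K0 x : x = 0 -> ipow K 3 x by move=> ->; apply: id0.
    by apply: pow4I; apply: K0; ring.
  by move=> a' /(has_len_uniq hp4) ->.
pose E := mpre kos3 (@mfull R R4) (ipow K 4).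
have sE : submod E by apply: mpre_submod => //; exact: (hKk 4).
(* Exactness at $(R/K^3)^4$: a value in $K^4=QK^3$ is also taken at some [z] with entries in $K^3$,
   and [b - z] is a cycle over [R] itself. *)
have eE : mimg kos2 (pow4 (ipow K 3)) (@mfull R R6) = E.
  apply: mset_ext.
    move=> _ [c [z [_ hz ->]]]; split=> //; rewrite linearD /=.
    have -> : kos3 (kos2 c) = 0.
      by case: c => [[[[[c1 c2] c3] c4] c5] c6] /=; ring.
    rewrite add0r; case: z hz => [[[z1 z2] z3] z4] [[[k1 k2] k3] k4].
    apply: (idD (hKk 4)); last exact: (KS 3%N).
    apply: (idD (hKk 4)); last exact: (KS 3%N).
    by apply: (idD (hKk 4)); apply: (KS 3%N).
  move=> b [_]; rewrite hKQ => /(imul_gen (hKk 3)) [c [hc e]].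
  pose z : R4 := (c 0%N, c 1%N, c 2%N, c 3%N).
  have [x hx] : exists x : R6, b - z = kos2 x.
    apply: kos_exact; rewrite linearB /= e !big_ord_recl big_ord0 /=; ring.
  exists x, z; split=> //; last by rewrite -[LHS](subrK z) hx.
  exact: pow4I.
have hu4 := proj1 (@has_len_pre R R6 R4 kos2 _ f6 _ u s4) hlu.
rewrite eE in hu4.
have s4E : msub (pow4 (ipow K 3)) E by case: hu4 => /lge_sub.
have [u' [v [hu' hv e3]]] := has_len_split s4 sE f4 s4E (fun _ _ => I) (pow4_len (hKk 3) h3).
have hv' := proj1 (@has_len_pre R R4 R^o kos3 _ f4 _ v (submod_ideal (hKk 4))) hv.
have eQ : mimg kos3 (ipow K 4) (@mfull R R4) = Q.
  apply: mset_ext => z.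
    move=> [[[[b1 b2] b3] b4] [w [_ hw ->]]].
    have QM x b : x \in [:: y1; y2; y3; y4] -> Q (x * b).
      by move=> hx; apply: idMr => //; apply: gen_mem.
    apply: idD => //; last by move: hw; rewrite hKQ; apply: imul_subl.
    by do !apply: idD => //; apply: QM; rewrite !inE eqxx ?orbT.
  move=> [c ->]; exists (c 0%N, c 1%N, c 2%N, c 3%N), 0; split=> //; first exact: (id0 (hKk 4)).
  by rewrite addr0 !big_ord_recl big_ord0 /=; ring.
rewrite eQ in hv'.
have ev := has_len_uniq hv' hq; have eu := has_len_uniq hu' hu4.
lia.
Qed.

End Koszul.

(** * Hilbert coefficients *)

Lemma poly_bound (A B C D E : int) n1 :
  (forall n : nat, (n1 <= n)%N ->
    A * n%:Z ^+ 4 + B * n%:Z ^+ 3 + C * n%:Z ^+ 2 + D * n%:Z + E <= 0) -> A <= 0.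
Proof.
move=> h; rewrite leNgt; apply/negP => hA.
(* As [A] is at least 1, this [n] makes the quartic term dominate; the nonnegative products below
   certify it. *)
pose n := (n1 + (`|B| + `|C| + `|D| + `|E|) + 1)%N.
have hn1 : (n1 <= n)%N by rewrite /n; lia.
have {h} := h n hn1; rewrite leNgt => /negP; apply.
set x : int := n%:Z; set b : int := `|B|%N; set c : int := `|C|%N.
set d : int := `|D|%N; set e : int := `|E|%N.
have hx1 : 0 <= x - 1 by rewrite /x /n; lia.
have hx : 0 <= x - b - c - d - e - 1 by rewrite /x /n /b /c /d /e; lia.
have [hb hc hd he] : [/\ 0 <= B + b, 0 <= C + c, 0 <= D + d & 0 <= E + e].
  by rewrite /b /c /d /e; split; lia.
have [hb' hc' hd' he'] : [/\ 0 <= b, 0 <= c, 0 <= d & 0 <= e] by [].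
have x0 : 0 <= x by [].
have x3 : 0 < x ^+ 3 by rewrite exprn_gt0 //; lia.
have p1 : 0 <= (A - 1) * x ^+ 4 by apply: mulr_ge0; [lia | apply: exprn_ge0].
have p2 : 0 <= x ^+ 3 * (x - b - c - d - e - 1) by apply: mulr_ge0 => //; apply: ltW.
have p3 : 0 <= (B + b) * x ^+ 3 by apply: mulr_ge0 => //; apply: ltW.
have p4 : 0 <= (C + c) * x ^+ 2 by apply: mulr_ge0 => //; apply: exprn_ge0.
have p5 : 0 <= c * (x ^+ 2 * (x - 1)).
  by apply: mulr_ge0 => //; apply: mulr_ge0 => //; apply: exprn_ge0.
have p6 : 0 <= (D + d) * x by apply: mulr_ge0.
have p7 : 0 <= d * (x * (x - 1) * (x + 1)).
  by apply: mulr_ge0 => //; apply: mulr_ge0; [apply: mulr_ge0 | lia].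
have p8 : 0 <= e * ((x - 1) * (x ^+ 2 + x + 1)) by do 2!(apply: mulr_ge0 => //).
have -> : A * x ^+ 4 + B * x ^+ 3 + C * x ^+ 2 + D * x + E = x ^+ 3 +
  ((A - 1) * x ^+ 4 + x ^+ 3 * (x - b - c - d - e - 1) + (B + b) * x ^+ 3 +
   (C + c) * x ^+ 2 + c * (x ^+ 2 * (x - 1)) + (D + d) * x +
   d * (x * (x - 1) * (x + 1)) + e * ((x - 1) * (x ^+ 2 + x + 1)) + (E + e)) by ring.
by apply: ltr_wpDr => //; do 8!(apply: addr_ge0 => //).
Qed.

Lemma bin_int4 n : ('C(n + 3, 4))%:Z * 24 = n%:Z * (n%:Z + 1) * (n%:Z + 2) * (n%:Z + 3).
Proof.
have := bin_ffact (n + 3) 4; rewrite !ffactnS ffactn0 /= => h.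
have e1 : (n + 3).-1 = (n + 2)%N by lia.
have e2 : (n + 2).-1 = (n + 1)%N by lia.
have e3 : (n + 1).-1 = n by lia.
rewrite e1 e2 e3 (_ : 4`! = 24%N) // in h.
have -> : ('C(n + 3, 4))%:Z * 24 = ('C(n + 3, 4) * 24)%N%:Z by rewrite PoszM.
by rewrite h !PoszM !PoszD; ring.
Qed.

Lemma bin_int3 n : ('C(n + 2, 3))%:Z * 6 = n%:Z * (n%:Z + 1) * (n%:Z + 2).
Proof.
have := bin_ffact (n + 2) 3; rewrite !ffactnS ffactn0 /= => h.
have e2 : (n + 2).-1 = (n + 1)%N by lia.
have e3 : (n + 1).-1 = n by lia.
rewrite e2 e3 (_ : 3`! = 6%N) // in h.
have -> : ('C(n + 2, 3))%:Z * 6 = ('C(n + 2, 3) * 6)%N%:Z by rewrite PoszM.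
by rewrite h !PoszM !PoszD; ring.
Qed.

Lemma bin_int2 n : ('C(n + 1, 2))%:Z * 2 = n%:Z * (n%:Z + 1).
Proof.
have := bin_ffact (n + 1) 2; rewrite !ffactnS ffactn0 /= => h.
have e3 : (n + 1).-1 = n by lia.
rewrite e3 (_ : 2`! = 2%N) // in h.
have -> : ('C(n + 1, 2))%:Z * 2 = ('C(n + 1, 2) * 2)%N%:Z by rewrite PoszM.
by rewrite h !PoszM !PoszD; ring.
Qed.

(** The factor 24 clears the denominators of the binomials, leaving identities for [ring] over the
    integers. *)
Lemma hilb_poly4E (e0 e1 e2 e3 e4 : int) n : 24 * hilb_poly4 e0 e1 e2 e3 e4 n =
  e0 * (n%:Z * (n%:Z + 1) * (n%:Z + 2) * (n%:Z + 3))
  - 4 * e1 * (n%:Z * (n%:Z + 1) * (n%:Z + 2)) + 12 * e2 * (n%:Z * (n%:Z + 1))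
  - 24 * e3 * n%:Z + 24 * e4.
Proof. by rewrite -bin_int4 -bin_int3 -bin_int2 /hilb_poly4; ring. Qed.

(** A fourth difference of step [s] kills degrees below 4 and multiplies the coefficient $e_0/24$ of
    $n^4$ by $24s^4$; its term at 0 is $P(0)=e_4$. *)
Lemma hilb_poly4_alt (e0 e1 e2 e3 e4 : int) s :
  let P n := hilb_poly4 e0 e1 e2 e3 e4 n in
  P (s * 4)%N - 4 * P (s * 3)%N + 6 * P (s * 2)%N - 4 * P (s * 1)%N + e4 =
  e0 * s%:Z ^+ 4.
Proof.
move=> P; apply: (@mulfI _ 24) => //.
have -> : 24 * (P (s * 4)%N - 4 * P (s * 3)%N + 6 * P (s * 2)%N - 4 * P (s * 1)%N + e4) =
  24 * P (s * 4)%N - 4 * (24 * P (s * 3)%N) + 6 * (24 * P (s * 2)%N)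
  - 4 * (24 * P (s * 1)%N) + 24 * e4 by ring.
by rewrite /P !hilb_poly4E !PoszM; ring.
Qed.

(** $P(n+1)-P(n)$ has degree at most 3; [4 <= n] keeps the predecessors in [bdiff] from
    truncating. *)
Lemma hilb_poly4_diff (e0 e1 e2 e3 e4 : int) n : (4 <= n)%N ->
  iter 4 bdiff (fun n => hilb_poly4 e0 e1 e2 e3 e4 n.+1 - hilb_poly4 e0 e1 e2 e3 e4 n) n = 0.
Proof.
move=> hn; rewrite -(subnK hn); move: (n - 4)%N => k.
rewrite /= /bdiff !addnS /= addn0; apply: (@mulfI _ 24) => //.
by rewrite mulr0 !mulrBr !hilb_poly4E !intS; ring.
Qed.

Section LeadingCoefficient.
Variable R : comNzRingType.

(** $(ys)^n\subseteq I^{sn}$ gives $P(sn)\le l\binom{n+3}{4}$ for large [n]; the coefficients of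
    $n^4$ are compared. *)
Lemma leading_coef_le (I : ideal R) ys s l n0 (e0 e1 e2 e3 e4 : int) :
  is_ideal I -> size ys = 4%N -> isub (gen_ideal ys) (ipow I s) -> (0 < s)%N ->
  ilen (gen_ideal ys) unit_ideal l ->
  (forall n, (n0 <= n)%N -> exists2 k, ilen (ipow I n) unit_ideal k &
     k%:Z = hilb_poly4 e0 e1 e2 e3 e4 n) ->
  e0 * s%:Z ^+ 4 <= l%:Z.
Proof.
move=> hI hs hsub s0 hl hP; rewrite -subr_le0.
have h0 := @izero_ideal R; have hg := gen_ideal_ideal ys.
(* The lower coefficients in [n] of $24\,(P(sn)-l\binom{n+3}{4})$. *)
apply: (@poly_bound _ (6 * e0 * s%:Z ^+ 3 - 4 * e1 * s%:Z ^+ 3 - 6 * l%:Z)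
  (11 * e0 * s%:Z ^+ 2 - 12 * e1 * s%:Z ^+ 2 + 12 * e2 * s%:Z ^+ 2 - 11 * l%:Z)
  (6 * e0 * s%:Z - 8 * e1 * s%:Z + 12 * e2 * s%:Z - 24 * e3 * s%:Z - 6 * l%:Z)
  (24 * e4) n0) => n hn.
have hl' : ilen (isum izero (gen_ideal ys)) unit_ideal l by rewrite isumC isum0.
have [a ha hal] := ilen_ipow_gen h0 hl' n.
rewrite isumC isum0 in ha; last exact: ipow_ideal.
have [|k hk ek] := hP (s * n)%N; first by nia.
have [] := has_len_subl (V := R^o) (submod_ideal (ipow_ideal n hg))
  (submod_ideal (ipow_ideal (s * n) hI)) (submod_ideal (@unit_ideal_ideal R)) _ _ ha.
- by rewrite -ipowM //; apply: ipow_mono.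
- by [].
move=> k' hk' hk'a; move: (ilen_uniq hk hk') => ekk; rewrite -ekk in hk'a.
move: hal; rewrite hs addnS /= => hal.
have h1 : 24 * k%:Z <= l%:Z * (('C(n + 3, 4))%:Z * 24).
  have -> : l%:Z * (('C(n + 3, 4))%:Z * 24) = 24 * (l * 'C(n + 3, 4))%N%:Z.
    by rewrite PoszM; ring.
  by rewrite ler_pM2l // lez_nat; apply: leq_trans hk'a hal.
rewrite bin_int4 ek hilb_poly4E PoszM in h1.
rewrite -subr_le0 in h1; apply: le_trans h1; rewrite le_eqVlt; apply/orP; left.
apply/eqP; ring.
Qed.

End LeadingCoefficient.

Theorem theorem1p5 (R : comNzRingType) (m I J : ideal R)
  (e0 e1 e2 e3 e4 : int) :
  cohen_macaulay_local m 4 ->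
  infinite_residue_field m ->
  m_primary m I ->
  is_minimal_reduction J I ->
  asymptotically_normal I ->
  red_num_le J I 3 ->
  hilbert_coeffs4 I e0 e1 e2 e3 e4 ->
  e4 <= 0.
Proof.
move=> [Rnoeth [mloc [_ [zs [hzs [hzm hzreg]]]]]] [f hf] [[hI hI1] hIm].
move=> [[hJ [hJI [r /ideal_ext hr]]] hmin] [k0 [k00 hnorm]] [r3 [hr3 /ideal_ext hred]].
move=> [N hN]; set P := hilb_poly4 e0 e1 e2 e3 e4 in hN.
have hT := @unit_ideal_ideal R; have hP n := ipow_ideal n hI.
have hlen n : (N <= n)%N -> exists2 l, ilen (ipow I n) unit_ideal l & l%:Z = P n.
  by move=> /hN [l [hl el]]; exists l => //; apply: length_quot_ilen.
have [g /ideal_ext eg] := Rnoeth J hJ; rewrite eg in hJ hJI hr hmin hred.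
have hp0 : exists n0, forall n, (n0 <= n)%N ->
    exists2 l, ilen (ipow I n.+1) (ipow I n) l & l%:Z = P n.+1 - P n.
  exists N => n hn; have [a ha ea] := hlen n hn; have [b hb eb] := hlen n.+1 (leqW hn).
  have [||c [d [hc hd e]]] := ilen_split (hP n.+1) (hP n) hT _ _ hb => //.
    exact: ipow_le.
  by exists c => //; rewrite -ea -eb e (ilen_uniq ha hd) PoszD; ring.
have [xs [hxs hxg hxreg [n0 hn0]]] := reduction_exists Rnoeth mloc hf hI hIm hJI hr
  hp0 hzs hzm (regular_seq_reg hzreg).
have hxI : isub (gen_ideal xs) I.
  by apply: gen_sub => // x /hxg; apply: hJI.
(* Four differences leave length 0, so [xs] generate a reduction inside [J], and minimality makes it
   [J]. *)
have hxJ : gen_ideal xs = gen_ideal g.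
  apply: ideal_ext; apply: hmin; last exact: gen_sub.
  split; first exact: gen_ideal_ideal.
  split=> //; exists (maxn n0 4).
  suff -> : ipow I (maxn n0 4).+1 = imul (gen_ideal xs) (ipow I (maxn n0 4)) by [].
  apply: (reduction_of_len0 Rnoeth mloc hI hIm hxI) => k hk.
  have [l hl el] := hn0 k ltac:(lia).
  rewrite hilb_poly4_diff in el; last by lia.
  by move: el hl => [->].
rewrite -hxJ in hred.
have hxm x : x \in xs -> m x by move=> hx; apply/(isub_Im hIm)/hxI/gen_mem.
have hred4 : ipow I 4 = imul (gen_ideal xs) (ipow I 3).
  have -> : 4%N = (r3.+1 + (3 - r3))%N by lia.
  rewrite ipowD // hred -imulA //; last exact: gen_ideal_ideal.
  by rewrite -ipowD // subnKC.
(* [s >= N] makes $H=P$ at positive multiples of [s]; [s >= k0] makes all powers of [K] integrally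
   closed. *)
pose s := (N + k0)%N; have s0 : (0 < s)%N by rewrite /s; lia.
pose K := ipow I s; have hK : is_ideal K := hP s.
have eK n : ipow K n = ipow I (s * n) by apply: ipowM.
pose ys := [seq x ^+ s | x <- xs].
have hysK : isub (gen_ideal ys) K.
  by apply: gen_sub => // _ /mapP [x hx ->]; apply: mem_expr => //; apply/hxI/gen_mem.
have hg := gen_ideal_ideal ys; have hgx := gen_ideal_ideal xs.
have hKQ : ipow K 4 = imul (gen_ideal ys) (ipow K 3).
  apply: isub_antisym; last by rewrite [ipow K 4]ipowS; apply: imul_mono.
  have e : (s * 4 = (s * 4 - 3) + 3)%N by lia.
  rewrite !eK e.
  apply: isub_trans (ipow_reduction (j := (s * 4 - 3)%N) hI hgx hred4) _.
  (* $4(s-1)<4s-3$ with nothing to spare: four generators and reduction number 3 just fit. *)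
  have hpig : (size xs * s.-1 < s * 4 - 3)%N by rewrite hxs; lia.
  apply: isub_trans (imul_mono (ipow_pigeonhole hpig) (isub_refl (I := ipow I 3))) _.
  rewrite prednK // -imulA //; last exact: ipow_ideal.
  apply: imul_mono => //.
  apply: isub_trans (imul_mono (ipow_mono (n := (s * 4 - 3 - s)%N) hxI)
    (isub_refl (I := ipow I 3))) _.
  by rewrite -ipowD //; apply: ipow_le => //; lia.
have hreg : reg izero ys.
  by apply: (reg_exp Rnoeth mloc) => //; apply: izero_ideal.
have hKn n : (0 < n)%N -> integrally_closed (ipow K n).
  by move=> hn; rewrite eK; apply: hnorm; rewrite /s; nia.
have hlenK n : (0 < n)%N -> exists2 l, ilen (ipow K n) unit_ideal l & l%:Z = P (s * n)%N.
  by move=> hn; rewrite eK; apply: hlen; rewrite /s; nia.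
have hKl n : exists l, ilen (ipow K n) unit_ideal l.
  case: n => [|n]; first by exists 0%N; apply: ilen0.
  by have [l hl _] := hlenK n.+1 isT; exists l.
have hym y : y \in ys -> m y.
  move=> /mapP [x /hxm hx ->]; rewrite -(prednK s0) exprS.
  by apply: idMr => //; apply: local_ideal mloc.
have [h1 hh1 eh1] := hlenK 1%N isT; have [h2 hh2 eh2] := hlenK 2%N isT.
have [h3 hh3 eh3] := hlenK 3%N isT; have [h4 hh4 eh4] := hlenK 4%N isT.
have sys : size ys = 4%N by rewrite size_map.
have [l hl hb] : exists2 l, ilen (gen_ideal ys) unit_ideal l &
    (4 * h1 + 4 * h3 + l <= 6 * h2 + h4)%N.
  case: (ys) sys hysK hKQ hreg hym => [|y1 [|y2 [|y3 [|y4 []]]]] // _ hysK' hKQ' hreg' hym'.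
  exact: (koszul_bound Rnoeth mloc hreg' hK hKn hKl hym' hysK' hKQ' hh1 hh2 hh3 hh4).
have h0 := leading_coef_le hI sys hysK s0 hl hlen.
have := hilb_poly4_alt e0 e1 e2 e3 e4 s; rewrite -/P /= -eh1 -eh2 -eh3 -eh4.
lia.
Qed.
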